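(* Let $(\mathcal{M},\rho,\mathcal{Q},\eta,\Phi)$ be a special contact structure and let $\mathcal{N}\subset\mathcal{M}$ be a (not necessarily horizontal) Legendrian submanifold of the contact manifold $(\mathcal{M},\eta)$. Then locally there exists a Morse family generating $\mathcal{N}$: for every point $m\in\mathcal{N}$ there exist an open neighbourhood $U$ of $m$ in $\mathcal{N}$, an open subset $V\subset\mathcal{Q}$, a smooth fiber bundle $\tau:\mathcal{P}\to V$ and a Morse family $E:\mathcal{P}\to\mathbb{R}$ such that $\Phi(U)$ is the Legendrian submanifold of $T^*V\times\mathbb{R}\subset T^*\mathcal{Q}\times\mathbb{R}$ generated by $E$.
   Context: A contact manifold is a $(2n+1)$-dimensional manifold $\mathcal{M}$ with a one-form $\eta$ such that $(d\eta)^n\wedge\eta$ is nowhere zero. Its Reeb field $\mathcal{R}$ is determined by $\iota_{\mathcal{R}}\eta=1$, $\iota_{\mathcal{R}}d\eta=0$. The map $\flat:T\mathcal{M}\to T^*\mathcal{M}$, $\flat(v)=\iota_v d\eta+\eta(v)\eta$, is an isomorphism with inverse $\sharp$, and one sets $\sharp_\Lambda(\alpha)=\sharp\alpha-\alpha(\mathcal{R})\mathcal{R}$. A submanifold $\mathcal{N}\subset\mathcal{M}$ is Legendrian if $T\mathcal{N}=\sharp_\Lambda\big((T\mathcal{N})^{o}\big)$, where $(T\mathcal{N})^o$ is the annihilator of $T\mathcal{N}$ in $T^*\mathcal{M}|_{\mathcal{N}}$ (equivalently, $\dim\mathcal{N}=n$ and $\eta$ pulls back to zero on $\mathcal{N}$).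 For a manifold $\mathcal{Q}$, the extended cotangent bundle is $\mathcal{T}^*\mathcal{Q}=T^*\mathcal{Q}\times\mathbb{R}$ with contact form $\eta_{\mathcal{Q}}=dz-\theta_{\mathcal{Q}}$, where $\theta_{\mathcal{Q}}$ is the canonical one-form and $z$ is the coordinate on $\mathbb{R}$; in Darboux coordinates $(q^i,p_i,z)$, $\eta_{\mathcal{Q}}=dz-p_i\,dq^i$. Let $\pi^0_{\mathcal{Q}}:\mathcal{T}^*\mathcal{Q}\to\mathcal{Q}$ be the projection to the base. A Legendrian submanifold of $\mathcal{T}^*\mathcal{Q}$ is called horizontal if it is the image of a section of $\pi^0_{\mathcal{Q}}$. A special contact structure is a quintuple $(\mathcal{M},\rho,\mathcal{Q},\eta,\Phi)$ where $(\mathcal{M},\eta)$ is a contact manifold, $\rho:\mathcal{M}\to\mathcal{Q}$ is a fiber bundle, and $\Phi:\mathcal{M}\to\mathcal{T}^*\mathcal{Q}$ is a diffeomorphism with $\pi^0_{\mathcal{Q}}\circ\Phi=\rho$ and $\Phi^*\eta_{\mathcal{Q}}=\mu\,\eta$ for some nowhere vanishing function $\mu$. (The case $\mathcal{M}=\mathcal{T}^*\mathcal{Q}$, $\Phi=\mathrm{id}$ is included.) Let $\tau:\mathcal{P}\to\mathcal{Q}$ be a fiber bundle, $V\mathcal{P}=\ker T\tau$ its vertical bundle and $V^0\mathcal{P}\subset T^*\mathcal{P}$ the conormal bundle, i.e. the covectors vanishing on $V\mathcal{P}$. A function $E:\mathcal{P}\to\mathbb{R}$ is a Morse family if $T_w\,\mathrm{im}(dE)+T_wV^0\mathcal{P}=T_wT^*\mathcal{P}$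 for all $w\in\mathrm{im}(dE)\cap V^0\mathcal{P}$. In bundle coordinates $(q^i,\epsilon^a)$ on $\mathcal{P}$, the Legendrian submanifold of $\mathcal{T}^*\mathcal{Q}$ generated by the Morse family $E=E(q,\epsilon)$ is $$\Big\{\big(q^i,\tfrac{\partial E}{\partial q^i}(q,\epsilon),E(q,\epsilon)\big)\in\mathcal{T}^*\mathcal{Q}\;:\;\tfrac{\partial E}{\partial\epsilon^a}(q,\epsilon)=0\Big\}.$$ A Legendrian submanifold of $\mathcal{M}$ is generated by $E$ when its image under $\Phi$ is the Legendrian submanifold generated by $E$. *)

(* Defs.v *)
From HB Require Import structures.
From mathcomp Require Import all_boot all_order all_algebra all_fingroup.
From mathcomp Require Import all_classical all_reals all_analysis.
Set Implicit Arguments.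
Unset Strict Implicit.
Unset Printing Implicit Defensive.
Import Order.TTheory GRing.Theory Num.Theory.
Import numFieldNormedType.Exports.
Local Open Scope classical_set_scope.
Local Open Scope ring_scope.

Fixpoint Ck_on (R : realType) (V W : normedModType R) (k : nat)
    (O : set V) (f : V -> W) : Prop :=
  match k with
  | 0 => forall x, O x -> {for x, continuous f}
  | k'.+1 => (forall x, O x -> differentiable f x) /\
             (forall v, Ck_on k' O (fun x => 'D_v f x))
  end.

Definition smooth_on (R : realType) (V W : normedModType R)
    (O : set V) (f : V -> W) : Prop := forall k, Ck_on k O f.

(** Covectors and vectors are both given by rows of components. *)
Definition pair_mx (R : realType) (n : nat) (p v : 'rV[R]_n) : R :=
  \sum_(k < n) p 0 k * v 0 k.

(** Charts on a bare set: the topology is the one induced by the charts (see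
    [mopen]), and [crd i] is meaningful only on [dom i].  The manifold axioms
    are the separate predicate [manifold]. *)
Record atlas (R : realType) (n : nat) := Atlas {
  pt :> Type;
  idx : Type;
  dom : idx -> set pt;
  crd : idx -> pt -> 'rV[R]_n
}.

(** [along D c f] is f o (c|_D)^-1 on [c @` D], for c injective on D; it takes
    the junk value 0 elsewhere. *)
Definition along (X : Type) (R : realType) (n : nat) (T : zmodType)
    (D : set X) (c : X -> 'rV[R]_n) (f : X -> T) : 'rV[R]_n -> T :=
  fun u => xget 0 (f @` [set x | D x /\ c x = u]).

Section Manifolds.
Variables (R : realType).

Definition inchart n (X : atlas R n) (i : idx X) (T : zmodType) (f : X -> T) :
  'rV[R]_n -> T := along (dom i) (crd i) f.

Definition mopen n (X : atlas R n) (A : set X) : Prop :=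
  forall i : idx X, open (crd i @` (A `&` dom i)).

(** A local coordinate system c on D, smoothly compatible with the atlas. *)
Definition coord_system n (X : atlas R n) (D : set X) (c : X -> 'rV[R]_n) :
    Prop :=
  {in D &, injective c} /\
  forall i : idx X,
    [/\ open (c @` (D `&` dom i)), open (crd i @` (D `&` dom i)),
        smooth_on (c @` (D `&` dom i)) (along D c (crd i)) &
        smooth_on (crd i @` (D `&` dom i)) (inchart i c)].

Definition manifold n (X : atlas R n) : Prop :=
  [/\ forall x : X, exists i : idx X, dom i x,
      forall i : idx X, coord_system (dom i) (crd i),
      forall x y : X, x <> y -> exists A B : set X,
        [/\ mopen A, mopen B, A x, B y & A `&` B = set0] &
      exists B : nat -> set X, (forall k, mopen (B k)) /\
        forall A, mopen A -> forall x, A x -> exists k, B k x /\ B k `<=` A].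

(** Smoothness on the open set A.  Requiring the sets below to be open, for all
    charts, includes the continuity of f on A. *)
Definition smooth_map n m (X : atlas R n) (Y : atlas R m) (A : set X)
    (f : X -> Y) : Prop :=
  forall (i : idx X) (j : idx Y),
    let O := crd i @` (A `&` dom i `&` f @^-1` dom j) in
    open O /\ smooth_on O (inchart i (crd j \o f)).

Definition diffeo n m (X : atlas R n) (Y : atlas R m) (f : X -> Y) : Prop :=
  exists g : Y -> X,
    [/\ cancel f g, cancel g f, smooth_map setT f & smooth_map setT g].

(** The tangent map of f at x read in the charts i (at x) and j (at f x).
    Throughout, tangent vectors are given by their components in a chart. *)
Definition tmap n m (X : atlas R n) (Y : atlas R m) (f : X -> Y) (x : X)
    (i : idx X) (j : idx Y) : 'rV[R]_n -> 'rV[R]_m :=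
  'd (inchart i (crd j \o f)) (crd i x).

Definition line : atlas R 1 :=
  @Atlas R 1 R unit (fun=> setT) (fun=> fun x => const_mx x).

Definition prodM n m (X : atlas R n) (Y : atlas R m) : atlas R (n + m) :=
  @Atlas R (n + m) (X * Y)%type (idx X * idx Y)%type
    (fun ij => dom ij.1 `*` dom ij.2)
    (fun ij w => row_mx (crd ij.1 w.1) (crd ij.2 w.2)).

(** A covector at x: its components in all charts at x, subject to the
    transformation law.  Components in the other charts are normalised to 0 so
    that equal covectors are equal as terms. *)
Definition is_covec n (X : atlas R n) (x : X) (p : idx X -> 'rV[R]_n) : Prop :=
  (forall i j, dom i x -> dom j x ->
     forall v, pair_mx (p i) v = pair_mx (p j) (tmap (@id X) x i j v)) /\
  (forall i, ~ dom i x -> p i = 0).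

Record covec n (X : atlas R n) (x : X) := Covec {
  cmp :> idx X -> 'rV[R]_n;
  cmpP : is_covec x cmp
}.

(** The cotangent bundle, with its charts (x^i, p_i). *)
Definition cot n (X : atlas R n) : atlas R (n + n) :=
  @Atlas R (n + n) {x : X & covec x} (idx X)
    (fun i w => dom i (tag w))
    (fun i w => row_mx (crd i (tag w)) (tagged w i)).

Definition cbase n (X : atlas R n) (w : cot X) : X := tag w.

Definition mom n (X : atlas R n) (w : cot X) : idx X -> 'rV[R]_n := tagged w.

(** T_wS in the chart i, for a submanifold S: velocities of curves in S. *)
Definition tangent n (X : atlas R n) (S : set X) (w : X) (i : idx X) :
    set 'rV[R]_n :=
  [set v | exists (e : R) (g : line -> X),
     let I := [set t : line | `|t : R| < e] in
     [/\ 0 < e, smooth_map I g, forall t, I t -> S (g t),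
         g (0 : R) = w & v = derive1 (fun t : R => crd i (g t)) 0]].

(** Injectively immersed submanifolds, which include the embedded ones. *)
Definition submanifold k n (N : atlas R k) (X : atlas R n) (j : N -> X) : Prop :=
  [/\ manifold N, smooth_map setT j, injective j &
      forall (y : N) (a : idx N) (i : idx X), dom a y -> dom i (j y) ->
        injective (tmap j y a i)].

(** Fibre bundles t : P -> V over an open subset V of B, with typical fibre F;
    (t, h) is a local trivialisation over O, with inverse g. *)
Definition fiber_bundle p n (P : atlas R p) (B : atlas R n) (V : set B)
    (t : P -> B) : Prop :=
  [/\ mopen V, smooth_map setT t, range t = V &
   exists (f : nat) (F : atlas R f), manifold F /\
     forall b, V b -> exists O : set B,
       [/\ mopen O, O b, O `<=` V &
        exists (h : P -> F) (g : prodM B F -> P),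
          [/\ smooth_map (t @^-1` O) h,
              smooth_map (O `*` setT : set (prodM B F)) g,
              forall x, O (t x) -> g (t x, h x) = x &
              forall y, O y.1 -> t (g y) = y.1 /\ h (g y) = y.2]]].

(** alpha /\ beta for alternating forms, with the normalisation 1/(k! l!). *)
Definition wedge (V : Type) k l (a : ('I_k -> V) -> R) (b : ('I_l -> V) -> R) :
    ('I_(k + l) -> V) -> R :=
  fun v => ((k`! * l`!)%N%:R)^-1 * \sum_(s : 'S_(k + l))
    (-1) ^+ s * a (fun i => v (s (lshift l i)))
              * b (fun i => v (s (rshift k i))).

Fixpoint wedge_pow2 (V : Type) (w : ('I_2 -> V) -> R) (n : nat) :
    ('I_(n * 2) -> V) -> R :=
  match n return ('I_(n * 2) -> V) -> R with
  | 0 => fun=> 1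
  | n'.+1 => wedge w (@wedge_pow2 V w n')
  end.

Section Contact.
Variables (d : nat) (M : atlas R d) (eta : forall x : M, covec x).

Definition form_in (i : idx M) : 'rV[R]_d -> 'rV[R]_d :=
  inchart i (fun x => eta x i).

(** d eta (u, v) for vectors with components u, v in the chart i at x. *)
Definition dform (x : M) (i : idx M) (u v : 'rV[R]_d) : R :=
  pair_mx ('D_u (form_in i) (crd i x)) v - pair_mx ('D_v (form_in i) (crd i x)) u.

Definition reeb (x : M) (i : idx M) : 'rV[R]_d :=
  xget 0 [set r | pair_mx (eta x i) r = 1 /\ forall v, dform x i r v = 0].

Definition flat (x : M) (i : idx M) (v : 'rV[R]_d) : 'rV[R]_d :=
  \row_k dform x i v (delta_mx 0 k) + pair_mx (eta x i) v *: eta x i.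

Definition sharp (x : M) (i : idx M) (a : 'rV[R]_d) : 'rV[R]_d :=
  xget 0 [set v | flat x i v = a].

Definition sharpL (x : M) (i : idx M) (a : 'rV[R]_d) : 'rV[R]_d :=
  sharp x i a - pair_mx a (reeb x i) *: reeb x i.

Definition annihilator (T : set 'rV[R]_d) : set 'rV[R]_d :=
  [set a | forall v, T v -> pair_mx a v = 0].

Definition legendrian k (N : atlas R k) (j : N -> M) : Prop :=
  submanifold j /\
  forall (y : N) (a : idx N) (i : idx M), dom a y -> dom i (j y) ->
    let TN := range (tmap j y a i) in
    TN = sharpL (j y) i @` annihilator TN.

End Contact.

Definition contact_manifold n (M : atlas R (n * 2 + 1))
    (eta : forall x : M, covec x) : Prop :=
  [/\ manifold M,
      forall i : idx M, smooth_on (crd i @` dom i) (form_in eta i) &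
      forall (x : M) (i : idx M), dom i x ->
        exists v : 'I_(n * 2 + 1) -> 'rV[R]_(n * 2 + 1),
          wedge (@wedge_pow2 _ (fun u => dform eta x i (u 0) (u 1)) n)
                (fun u : 'I_1 -> _ => pair_mx (eta x i) (u 0)) v != 0].

Definition ecot n (Q : atlas R n) : atlas R (n + n + 1) := prodM (cot Q) line.

Definition epi n (Q : atlas R n) (w : ecot Q) : Q := cbase w.1.

(** dz - p_i dq^i in the Darboux chart j. *)
Definition eta_can n (Q : atlas R n) (w : ecot Q) (j : idx (ecot Q)) :
    'rV[R]_(n + n + 1) :=
  row_mx (row_mx (- mom w.1 j.1) 0) (const_mx 1).

Definition special_contact n (M : atlas R (n * 2 + 1)) (Q : atlas R n)
    (rho : M -> Q) (eta : forall x : M, covec x) (Phi : M -> ecot Q) : Prop :=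
  [/\ contact_manifold eta, manifold Q, fiber_bundle setT rho,
      diffeo Phi /\ (forall x, epi (Phi x) = rho x) &
      exists mu : M -> R, (forall x, mu x != 0) /\
        forall (x : M) (i : idx M) (j : idx (ecot Q)),
          dom i x -> dom j (Phi x) -> forall v,
          pair_mx (eta_can (Phi x) j) (tmap Phi x i j v)
            = mu x * pair_mx (eta x i) v].

Section Morse.
Variables (p n : nat) (P : atlas R p) (Q : atlas R n) (t : P -> Q).

Definition dfun (E : P -> R) (b : P) (i : idx P) : 'rV[R]_p -> R :=
  'd (inchart i E : 'rV[R]_p -> R^o) (crd i b).

Definition im_d (E : P -> R) : set (cot P) :=
  [set w | forall i, dom i (cbase w) ->
     forall v, pair_mx (mom w i) v = dfun E (cbase w) i v].

Definition vertical (b : P) (i : idx P) : set 'rV[R]_p :=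
  [set v | forall j : idx Q, dom j (t b) -> tmap t b i j v = 0].

Definition conormal : set (cot P) :=
  [set w | forall i, dom i (cbase w) ->
     forall v, vertical (cbase w) i v -> pair_mx (mom w i) v = 0].

Definition morse_family (E : P -> R) : Prop :=
  smooth_map setT (E : P -> line) /\
  forall w : cot P, im_d E w -> conormal w ->
    forall i : idx (cot P), dom i w -> forall v, exists a b,
      [/\ tangent (im_d E) w i a, tangent conormal w i b & v = a + b].

End Morse.

(** Bundle coordinates (q, eps) on D, where q comes from the chart j of Q. *)
Definition bundle_coords n l (P : atlas R (n + l)) (Q : atlas R n) (t : P -> Q)
    (D : set P) (j : idx Q) (eps : P -> 'rV[R]_l) : Prop :=
  t @` D `<=` dom j /\
  coord_system D (fun b => row_mx (crd j (t b)) (eps b)).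

(** The points (q, dE/dq, E) of T*Q x R such that dE/deps = 0. *)
Definition generated n l (P : atlas R (n + l)) (Q : atlas R n) (t : P -> Q)
    (E : P -> R) : set (ecot Q) :=
  [set w | exists (b : P) (D : set P) (j : idx Q) (eps : P -> 'rV[R]_l),
     let c := fun b => row_mx (crd j (t b)) (eps b) in
     let dE := 'd (along D c E : 'rV[R]_(n + l) -> R^o) (c b) in
     [/\ bundle_coords t D j eps /\ D b,
         cbase w.1 = t b,
         forall u : 'rV[R]_n, pair_mx (mom w.1 j) u = dE (row_mx u 0),
         w.2 = E b &
         forall u : 'rV[R]_l, dE (row_mx 0 u) = 0]].

End Manifolds.

(* Main.v *)
(** In the chart of [T*Q x R] induced by a chart of [Q], a Legendrian submanifold
    is parametrised by [y |-> (q(y), p(y), z(y))] with [dz = p dq], hence with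
    [dp^T dq] symmetric (Schwarz).  This symmetry makes the vectors [dq v], for
    [dp v = t dq v] with distinct [t], mutually orthogonal, so
    [S = dp - t dq] is invertible at a given point for some real [t], and then on
    a neighbourhood of it.  The parameters [y] serve as fibre coordinates: put
      [E(x, y) = z(y) + p(y).(x - q(y)) + t/2 |x - q(y)|^2].
    Then [dE/dx = p(y) + t (x - q(y))] and [dE/dy . v = (x - q(y)).(S v)], so the
    fibre derivative vanishes exactly where [x = q(y)], and there [dE/dx = p(y)]
    and [E = z(y)].  The Morse condition holds because [dE/dy] is affine in [x]
    with the invertible linear part [S^T]. *)

From mathcomp Require Import all_fingroup.
Require Import Defs.
From HB Require Import structures.
From mathcomp Require Import all_boot all_order all_algebra.
From mathcomp Require Import all_classical all_reals all_analysis.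
From mathcomp Require Import ring.
Set Implicit Arguments.
Unset Strict Implicit.
Unset Printing Implicit Defensive.
Import Order.TTheory GRing.Theory Num.Theory.
Import numFieldNormedType.Exports.
Local Open Scope classical_set_scope.
Local Open Scope ring_scope.

(** * Functions of class C^k *)

(** With [t = 0] the family works only where [dp] is invertible, which fails already on the zero
    section. The quadratic term comes from the shear [(q, p, z) |-> (q, p - t q, z - t/2 |q|^2)],
    which preserves [dz - p dq] and replaces [dp] by [dp - t dq]: up to the summand [t/2 |x|^2], [E]
    is the family with [t = 0] of the sheared submanifold. Two facts are not built into the
    definitions. The Legendrian condition is stated through [sharpL], so the vanishing of [eta] on
    [TN] and then, by a rank count, [dim N = n] have to be derived; this rests on the invertibility
    of [flat], extracted from the nonvanishing of the volume form. And [generated] admits bundle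
    coordinates over any chart of [Q], so the inclusion of the generated set in the image of [Phi]
    must be checked for all of them, not only for the coordinates in which [E] is written. *)

Section NearDifferential.
Variables (R : realType) (V W : normedModType R).
Implicit Types (f g : V -> W) (x : V).

Lemma is_diff_near0 f x : (\forall y \near x, f y = 0) -> is_diff x f 0.
Proof.
move=> f0; have fx0 : f x = 0 by exact: (nbhs_singleton f0).
have df0 : continuous (\0 : {linear V -> W}) by move=> y; exact: cvg_cst.
have fo : f \o shift x = cst (f x) + (\0 : {linear V -> W}) +o_ 0 id.
  apply/eqaddoP => e e0; near=> y.
  rewrite !fctE /= fx0 addr0 subr0.
  suff -> : f (y + x) = 0 by rewrite normr0 mulr_ge0// ltW.
  near: y.
  have := f0; rewrite (near_shift 0 x) /=.
  by apply: filterS => z; rewrite subr0.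
have dE := diff_unique df0 fo.
apply: DiffDef; last by rewrite dE.
by apply/diff_locallyP; rewrite dE; split.
Unshelve. all: by end_near. Qed.

Lemma near_differentiable f g x :
  (\forall y \near x, f y = g y) -> differentiable f x -> differentiable g x.
Proof.
move=> fg df; have -> : g = f + (g - f) by rewrite addrC subrK.
apply: differentiableD => //.
have h0 : \forall y \near x, (g - f) y = 0.
  by apply: filterS fg => y; rewrite !fctE => ->; rewrite subrr.
by have [] := is_diff_near0 h0.
Qed.

(** Chart expressions are meaningful only on the image of a chart, so computations of tangent maps
    replace them by explicit maps near the point. The differential depends only on the germ, also
    where it takes its default value. *)
Lemma near_diff f g x : (\forall y \near x, f y = g y) ->
  'd f x = 'd g x :> (V -> W).
Proof.
move=> fg; have gf : \forall y \near x, g y = f y by apply: filterS fg.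
have [df|ndf] := pselect (differentiable f x).
  rewrite funeqE => v; rewrite -!deriveE//; last exact: near_differentiable fg df.
  exact: near_eq_derive.
have ndg : ~ differentiable g x.
  by move=> dg; apply: ndf; exact: near_differentiable gf dg.
(* At a point of non-differentiability ['d] is the default linear map [point]. *)
have diff0 (h : V -> W) : ~ differentiable h x ->
    'd h x = point :> {linear V -> W}.
  move=> ndh; apply: getPN => L [Lc Lh]; apply: ndh.
  apply/diffP; have : exists L : {linear V -> W}, continuous L /\
    forall y, h y = h (lim (nbhs x)) + L (y - lim (nbhs x))
                +o_(y \near x) (y - lim (nbhs x)) by exists L.
  by move=> /getPex.
by rewrite !diff0.
Qed.

End NearDifferential.

Section Ck.
Variables (R : realType) (V : normedModType R).

Section General.
Variable W : normedModType R.
Implicit Types (f g : V -> W) (O : set V).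

Lemma Ck_on_continuous k O f x : Ck_on k O f -> O x -> {for x, continuous f}.
Proof.
case: k => [|k]; first by move=> cf; exact: cf.
by move=> [df _] Ox; apply: differentiable_continuous; exact: df.
Qed.

Lemma Ck_on_pred k O f : Ck_on k.+1 O f -> Ck_on k O f.
Proof.
elim: k f => [|k IH] f.
  by move=> fk x Ox; exact: Ck_on_continuous fk Ox.
by move=> [df Df]; split=> // v; apply: IH; exact: Df.
Qed.

Lemma Ck_on_sub k O O' f : O' `<=` O -> Ck_on k O f -> Ck_on k O' f.
Proof.
move=> OO; elim: k f => [|k IH] f; first by move=> cf x /OO; exact: cf.
by move=> [df Df]; split=> [x /OO|v]; [exact: df|apply: IH; exact: Df].
Qed.

(** Openness of [O] turns agreement on [O] into equality of germs, which is all that derivatives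
    see. The algebraic rules below rely on it, since rules such as that for the derivative of a
    product hold only on [O]. *)
Lemma Ck_on_ext k O f g : open O -> (forall x, O x -> f x = g x) ->
  Ck_on k O f -> Ck_on k O g.
Proof.
move=> oO; elim: k f g => [|k IH] f g fg.
  move=> cf x Ox; have nfg : \forall y \near x, f y = g y.
    by apply: filterS (open_nbhs_nbhs (conj oO Ox)) => y; exact: fg.
  rewrite /prop_for /continuous_at -fg//.
  apply: cvg_trans (cf x Ox).
  by apply: near_eq_cvg; apply: filterS nfg => y ->.
have nfg x : O x -> \forall y \near x, f y = g y.
  by move=> Ox; apply: filterS (open_nbhs_nbhs (conj oO Ox)) => y; exact: fg.
move=> [df Df]; split=> [x Ox|v].
  by apply: near_differentiable (df x Ox); exact: nfg.
apply: IH (Df v) => x Ox; apply: near_eq_derive; exact: nfg.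
Qed.

Lemma Ck_on_cst k O (c : W) : Ck_on k O (cst c : V -> W).
Proof.
elim: k c => [|k IH] c; first by move=> x _; exact: cvg_cst.
split=> [x _|v]; first exact: differentiable_cst.
have -> : (fun x => 'D_v (cst c : V -> W) x) = cst 0.
  by rewrite funeqE => x; rewrite derive_cst.
exact: IH.
Qed.

Lemma Ck_onD k O f g : open O -> Ck_on k O f -> Ck_on k O g ->
  Ck_on k O (fun x => f x + g x).
Proof.
move=> oO; elim: k f g => [|k IH] f g.
  by move=> cf cg x Ox; apply: cvgD; [exact: cf|exact: cg].
move=> [df Df] [dg Dg]; split=> [x Ox|v].
  by apply: differentiableD; [exact: df|exact: dg].
apply: (Ck_on_ext oO _ (IH _ _ (Df v) (Dg v))) => x Ox.
rewrite deriveD//; apply: diff_derivable; [exact: df|exact: dg].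
Qed.

Lemma Ck_on_sum k O n (f : 'I_n -> V -> W) : open O ->
  (forall i, Ck_on k O (f i)) -> Ck_on k O (fun x => \sum_i f i x).
Proof.
move=> oO; elim: n f => [|n IH] f fi.
  have -> : (fun x => \sum_i f i x) = cst 0.
    by rewrite funeqE => x; rewrite big_ord0.
  exact: Ck_on_cst.
have -> : (fun x => \sum_i f i x) =
    (fun x => f ord0 x + \sum_i f (lift ord0 i) x).
  by rewrite funeqE => x; rewrite big_ord_recl.
by apply: Ck_onD => //; apply: IH.
Qed.

End General.

Lemma Ck_on_lin_comp (W W' : normedModType R) k O (f : V -> W)
    (L : {linear W -> W'}) : open O -> continuous L ->
  Ck_on k O f -> Ck_on k O (L \o f).
Proof.
move=> oO cL; elim: k f => [|k IH] f.
  by move=> cf x Ox; apply: continuous_comp; [exact: cf|exact: cL].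
move=> [df Df]; have dL y : differentiable L y by exact: linear_differentiable.
split=> [x Ox|v]; first by apply: differentiable_comp; [exact: df|exact: dL].
apply: (Ck_on_ext oO _ (IH _ (Df v))) => x Ox /=.
have dfx := df x Ox; rewrite [RHS]deriveE; last exact: differentiable_comp.
by rewrite diff_comp//= diff_lin// deriveE.
Qed.

Lemma Ck_on_id k O : Ck_on k O (@id V).
Proof.
case: k => [|k]; first by move=> x _; exact: cvg_id.
split=> [x _|v]; first by [].
have -> : (fun x : V => 'D_v id x) = cst v.
  by rewrite funeqE => x; rewrite derive_id.
exact: Ck_on_cst.
Qed.

Lemma Ck_on_lin (W : normedModType R) k O (L : {linear V -> W}) : open O ->
  continuous L -> Ck_on k O L.
Proof. by move=> oO cL; have /= := Ck_on_lin_comp oO cL (Ck_on_id k O). Qed.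

Lemma Ck_onM k O (f g : V -> R) : open O -> Ck_on k O f -> Ck_on k O g ->
  Ck_on k O (fun x => f x * g x).
Proof.
move=> oO; elim: k f g => [|k IH] f g.
  by move=> cf cg x Ox; apply: cvgM; [exact: cf|exact: cg].
move=> fk gk; have [df Df] := fk; have [dg Dg] := gk; split=> [x Ox|v].
  by apply: differentiableM; [exact: df|exact: dg].
apply: (Ck_on_ext oO _ (Ck_onD oO (IH _ _ (Ck_on_pred fk) (Dg v))
                                  (IH _ _ (Ck_on_pred gk) (Df v)))) => x Ox.
by rewrite deriveM//; apply: diff_derivable; [exact: df|exact: dg].
Qed.

Lemma Ck_on_prod k O n (f : 'I_n -> V -> R) : open O ->
  (forall i, Ck_on k O (f i)) -> Ck_on k O (fun x => \prod_i f i x).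
Proof.
move=> oO; elim: n f => [|n IH] f fi.
  have -> : (fun x => \prod_i f i x) = cst 1.
    by rewrite funeqE => x; rewrite big_ord0.
  exact: Ck_on_cst.
have -> : (fun x => \prod_i f i x) =
    (fun x => f ord0 x * \prod_i f (lift ord0 i) x).
  by rewrite funeqE => x; rewrite big_ord_recl.
by apply: Ck_onM => //; apply: IH.
Qed.

End Ck.

(** * Row vectors by coordinates, and composition of C^k maps *)

Section Coordinates.
Variables (R : realType) (n : nat).

Definition rcoord (j : 'I_n) (u : 'rV[R]_n) : R^o := u 0 j.

Lemma rcoord_is_linear (j : 'I_n) : linear (rcoord j).
Proof. by move=> a u v; rewrite /rcoord !mxE. Qed.

HB.instance Definition _ (j : 'I_n) :=
  GRing.isLinear.Build R 'rV[R]_n R^o _ _ (rcoord_is_linear j).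

Lemma linear_rV_continuous (W : normedModType R) (L : {linear 'rV[R]_n -> W}) :
  continuous L.
Proof.
move=> x; have -> : (L : _ -> _) = (fun u => \sum_j u 0 j *: L (delta_mx 0 j)).
  rewrite funeqE => u; rewrite [in LHS](row_sum_delta u) linear_sum.
  by apply: eq_bigr => j _; rewrite linearZ.
(* Continuity is [Ck_on] of order 0 on the whole space, so closure under finite sums applies. *)
apply: (@Ck_on_sum _ _ _ 0 setT) => //; first exact: openT.
move=> j y _; apply: cvgZr_tmp; first exact: (@nbhs_filter _ y).
exact: (@coord_continuous R 1 n 0 j y).
Qed.

Lemma Ck_on_rV (V : normedModType R) k (O : set V) (f : V -> 'rV[R]_n) :
  open O -> (forall j, Ck_on k O (fun x => f x 0 j : R)) -> Ck_on k O f.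
Proof.
move=> oO fk; have -> : f = (fun x => \sum_j f x 0 j *: delta_mx 0 j).
  by rewrite funeqE => x; rewrite [LHS]row_sum_delta.
apply: Ck_on_sum => // j.
pose sc := fun a : R^o => a *: (delta_mx 0 j : 'rV[R]_n).
have sc_lin : linear sc by move=> a u v; rewrite /sc scalerDl scalerA.
pose scM := GRing.isLinear.Build _ _ _ _ sc sc_lin.
pose scL : {linear R^o -> 'rV[R]_n} := HB.pack sc scM.
apply: (@Ck_on_lin_comp _ _ _ _ _ _ _ scL) => //.
exact: scalel_continuous.
Qed.

Lemma Ck_on_coord (V : normedModType R) k (O : set V) (f : V -> 'rV[R]_n) j :
  open O -> Ck_on k O f -> Ck_on k O (fun x => f x 0 j : R).
Proof.
move=> oO fk; apply: (Ck_on_lin_comp oO _ fk (L := rcoord j)).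
exact: linear_rV_continuous.
Qed.

End Coordinates.

Section Composition.
Variable R : realType.

(** By the chain rule, ['D_v (g \o f)] is the sum over [j] of the [j]-th coordinate of ['D_v f]
    times the [j]-th partial of [g] composed with [f]. Each factor is of class C^k, by induction for
    the second one. *)
Lemma Ck_on_comp_real (V : normedModType R) m k (O : set V) (O' : set 'rV[R]_m)
    (f : V -> 'rV[R]_m) (g : 'rV[R]_m -> R) : open O -> open O' ->
  (forall x, O x -> O' (f x)) ->
  Ck_on k O f -> Ck_on k O' g -> Ck_on k O (g \o f).
Proof.
move=> oO oO' fO; elim: k g => [|k IH] g.
  move=> cf cg x Ox; apply: continuous_comp; [exact: cf|exact/cg/fO].
move=> fk [dg Dg]; have [df Df] := fk.
have dgf x : O x -> differentiable (g \o f) x.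
  by move=> Ox; apply: differentiable_comp; [exact: df|exact/dg/fO].
split=> // v.
pose h x := \sum_j ('D_v f x) 0 j * ('D_(delta_mx 0 j) g \o f) x.
apply: (@Ck_on_ext _ _ _ _ _ h) => // [x Ox|].
  rewrite deriveE; last exact: dgf.
  have dfx := df x Ox; have dgx := dg _ (fO _ Ox).
  have dfv : 'd f x v = 'D_v f x by rewrite deriveE.
  rewrite diff_comp//= dfv [in RHS](row_sum_delta ('D_v f x)) linear_sum.
  rewrite /h; apply: eq_bigr => j _.
  by rewrite linearZ /= -deriveE.
apply: Ck_on_sum => // j; apply: Ck_onM => //.
  by apply: Ck_on_coord => //; exact: Df.
by apply: IH; [exact: Ck_on_pred|exact: Dg].
Qed.

Lemma Ck_on_comp (V : normedModType R) m n k (O : set V) (O' : set 'rV[R]_m)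
    (f : V -> 'rV[R]_m) (g : 'rV[R]_m -> 'rV[R]_n) : open O -> open O' ->
  (forall x, O x -> O' (f x)) ->
  Ck_on k O f -> Ck_on k O' g -> Ck_on k O (g \o f).
Proof.
move=> oO oO' fO fk gk; apply: Ck_on_rV => // j.
by apply: (Ck_on_comp_real oO oO' fO fk (g := fun y => g y 0 j)); exact: Ck_on_coord.
Qed.

Lemma Ck_on_row_mx (V : normedModType R) m n k (D : set V)
    (f : V -> 'rV[R]_m) (g : V -> 'rV[R]_n) :
  open D -> Ck_on k D f -> Ck_on k D g -> Ck_on k D (fun x => row_mx (f x) (g x)).
Proof.
move=> oD fk gk; apply: Ck_on_rV => // i.
case: (split_ordP i) => i' ->;
  [have := Ck_on_coord i' oD fk|have := Ck_on_coord i' oD gk];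
  by apply: Ck_on_ext => // x _; rewrite ?row_mxEl ?row_mxEr.
Qed.

End Composition.

(** * Symmetry of second derivatives *)

Section Schwarz.
Variables (R : realType) (V : normedModType R).
Implicit Types (f : V -> R) (O : set V).

Lemma is_derive_line f (y w : V) (s : R) : differentiable f (y + s *: w) ->
  is_derive s 1 (fun t : R => f (y + t *: w)) ('D_w f (y + s *: w)).
Proof.
move=> df.
have E : (fun h : R => h^-1 *: (f (y + (h *: 1 + s) *: w) - f (y + s *: w))) =
    (fun h : R => h^-1 *: (f (h *: w + (y + s *: w)) - f (y + s *: w))).
  rewrite funeqE => h; congr (_ *: (f _ - _)).
  by rewrite [h *: 1]mulr1 scalerDl addrCA.
have dv : derivable f (y + s *: w) w by exact: diff_derivable.
by split; rewrite /derivable /derive /= E.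
Qed.

Lemma line_mvt f (y w : V) (h : R) : 0 < h ->
  (forall s, 0 <= s <= h -> differentiable f (y + s *: w)) ->
  exists2 s, 0 <= s <= h & f (y + h *: w) - f y = h * 'D_w f (y + s *: w).
Proof.
move=> h0 df; pose g := fun t : R => f (y + t *: w).
have dg s : 0 <= s <= h -> is_derive s 1 g ('D_w f (y + s *: w)).
  by move=> /df; exact: is_derive_line.
have [|c|s sI] := @MVT R g (fun s => 'D_w f (y + s *: w)) 0 h h0.
- by move=> x; rewrite in_itv /= => /andP[/ltW x0 /ltW xh]; apply: dg; rewrite x0.
- apply: derivable_within_continuous => x; rewrite in_itv /= => xI.
  by have [] := dg _ xI.
rewrite /g scale0r addr0 subr0 mulrC => E; exists s => //.
by move: sI; rewrite in_itv /= => /andP[/ltW -> /ltW ->].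
Qed.

Lemma derive_translate f (x w c : V) :
  'D_w (fun y => f (y + c)) x = 'D_w f (x + c).
Proof.
rewrite /derive; set A := (fun h : R => _); set B := (fun h : R => _).
by have -> : A = B by rewrite funeqE /A /B => h /=; rewrite addrA.
Qed.

Lemma dist_le_split (a b c e : R) :
  `|a - c| < e / 2 -> `|b - c| < e / 2 -> `|a - b| <= e.
Proof.
move=> /ltW ac /ltW bc; rewrite -(subrKA c) (le_trans (ler_normD _ _))//.
by rewrite [e]splitr lerD// distrC.
Qed.

(** The mean value theorem is used twice: along [u] for the increment [f (y + h v) - f y], then
    along [v] for ['D_u f]. *)
Lemma second_difference O f (x u v : V) (h : R) : Ck_on 2 O f -> 0 < h ->
  (forall s t, 0 <= s <= h -> 0 <= t <= h -> O (x + s *: u + t *: v)) ->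
  exists s t, [/\ 0 <= s <= h, 0 <= t <= h &
    f (x + h *: u + h *: v) - f (x + h *: u) - f (x + h *: v) + f x
    = h * (h * 'D_v ('D_u f) (x + s *: u + t *: v))].
Proof.
move=> [df /(_ u)[dDf _]] h0 Osq.
have h00 : 0 <= (0 : R) <= h by rewrite lexx ltW.
have hh : 0 <= h <= h by rewrite lexx ltW.
have Ou s : 0 <= s <= h -> O (x + s *: u).
  by move=> sh; have := Osq s 0 sh h00; rewrite scale0r addr0.
pose g y := f (y + h *: v) - f y.
have dfv s : 0 <= s <= h -> differentiable (fun y => f (y + h *: v)) (x + s *: u).
  move=> sh; apply: (@differentiable_comp _ _ _ _ (fun y => y + h *: v) f).
    exact: differentiableD.
  exact/df/Osq.
have [s sh E] : exists2 s, 0 <= s <= h &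
    g (x + h *: u) - g x = h * 'D_u g (x + s *: u).
  apply: line_mvt => // s sh; apply: differentiableB; first exact: dfv.
  exact/df/Ou.
have [t th E2] : exists2 t, 0 <= t <= h &
    'D_u f (x + s *: u + h *: v) - 'D_u f (x + s *: u)
    = h * 'D_v ('D_u f) (x + s *: u + t *: v).
  apply: (@line_mvt ('D_u f) (x + s *: u) v h h0) => t th.
  exact: dDf (Osq s t sh th).
exists s, t; split=> //.
rewrite -E2; have -> : 'D_u f (x + s *: u + h *: v) - 'D_u f (x + s *: u) =
   'D_u g (x + s *: u).
  rewrite /g deriveB; last 2 first.
  - by apply: diff_derivable; exact: dfv.
  - by apply: diff_derivable; exact/df/Ou.
  by rewrite derive_translate.
by rewrite -E /g opprB addrA addrAC.
Qed.

(** The second difference is symmetric in [u] and [v]; equating its two expressions and cancelling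
    [h] twice makes the mixed derivatives agree at two nearby points. *)
Lemma second_difference_sym O f (x u v : V) (h : R) : Ck_on 2 O f -> 0 < h ->
  (forall s t, 0 <= s <= h -> 0 <= t <= h -> O (x + s *: u + t *: v)) ->
  (forall s t, 0 <= s <= h -> 0 <= t <= h -> O (x + s *: v + t *: u)) ->
  exists s t s' t',
    [/\ 0 <= s <= h, 0 <= t <= h, 0 <= s' <= h, 0 <= t' <= h &
    'D_v ('D_u f) (x + s *: u + t *: v) = 'D_u ('D_v f) (x + s' *: v + t' *: u)].
Proof.
move=> f2 h0 Ouv Ovu.
have [s [t [sh th E1]]] := second_difference f2 h0 Ouv.
have [s' [t' [sh' th' E2]]] := second_difference f2 h0 Ovu.
exists s, t, s', t'; split; [exact: sh|exact: th|exact: sh'|exact: th'|].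
move: E1 E2; set a := 'D_v _ _; set b := 'D_u _ _; rewrite (addrAC x).
set c1 := f _; set c2 := f _; set c3 := f _; rewrite (addrAC c1) => -> E.
by apply: (mulfI (lt0r_neq0 h0)); apply: (mulfI (lt0r_neq0 h0)).
Qed.

Lemma derive_derive_sym O f (x u v : V) : open O -> Ck_on 2 O f -> O x ->
  'D_u ('D_v f) x = 'D_v ('D_u f) x.
Proof.
move=> oO f2 Ox.
have cont w w' : {for x, continuous ('D_w ('D_w' f))}.
  by have [_ /(_ w')[_ /(_ w)]] := f2; apply.
apply/eqP; rewrite -subr_eq0 -normr_le0; apply/ler_addgt0Pr => e e0; rewrite add0r.
have near_cont w w' : \forall y \near x,
    `|'D_w ('D_w' f) x - 'D_w ('D_w' f) y| < e / 2.
  have /cvgrPdist_lt := cont w w'; apply; exact: divr_gt0.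
have /nbhs_ballP[d /= d0 dP] : \forall y \near x, [/\ O y,
    `|'D_u ('D_v f) x - 'D_u ('D_v f) y| < e / 2 &
    `|'D_v ('D_u f) x - 'D_v ('D_u f) y| < e / 2].
  have := open_nbhs_nbhs (conj oO Ox).
  by apply: filterS3 (near_cont u v) (near_cont v u) => y A B C; split.
pose M := `|u| + `|v| + 1; have M0 : 0 < M by rewrite ltr_wpDl// addr_ge0.
(* The parallelogram has diameter controlled by [h * M = d / 2 < d], so it stays in the ball; the
   summand 1 in [M] keeps [M] positive when [u = v = 0]. *)
pose h := d / (2 * M); have h0 : 0 < h by rewrite divr_gt0// mulr_gt0.
have in_ball w w' s t : `|w| + `|w'| + 1 = M -> 0 <= s <= h -> 0 <= t <= h ->
    ball x d (x + s *: w + t *: w').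
  move=> wM /andP[s0 sh] /andP[t0 th]; rewrite -ball_normE /= -addrA opprD addNKr.
  rewrite normrN; apply: (le_lt_trans (ler_normD _ _)); rewrite !normrZ !ger0_norm//.
  apply: (@le_lt_trans _ _ (h * M)).
    rewrite -wM !mulrDr mulr1 -addrA lerD ?ler_wpM2r//.
    by rewrite -[leLHS]addr0 lerD ?ler_wpM2r// ltW.
  rewrite /h invfM mulrA divfK ?gt_eqF// ltr_pdivrMr// mulr_natr mulr2n.
  by rewrite ltrDl.
have MC : `|v| + `|u| + 1 = M by rewrite [`|v| + _]addrC.
have [s [t [s' [t' [sh th sh' th' E]]]]] := second_difference_sym f2 h0
  (fun s t sh th => let: And3 H _ _ := dP _ (in_ball u v s t erefl sh th) in H)
  (fun s t sh th => let: And3 H _ _ := dP _ (in_ball v u s t MC sh th) in H).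
have [_ _ P1] := dP _ (in_ball u v s t erefl sh th).
have [_ P2 _] := dP _ (in_ball v u s' t' MC sh' th').
rewrite E in P1.
exact: dist_le_split P2 P1.
Qed.

End Schwarz.

(** * Linear algebra of contact forms *)

Section MultilinearForms.
Variables (R : realType) (V : lmodType R).

Definition upd k (u : 'I_k -> V) (i : 'I_k) (x : V) : 'I_k -> V :=
  fun j => if j == i then x else u j.

Definition multilinear k (f : ('I_k -> V) -> R) : Prop :=
  forall u i (a : R) x y,
    f (upd u i (a *: x + y)) = a * f (upd u i x) + f (upd u i y).

Definition alternate k (f : ('I_k -> V) -> R) : Prop :=
  forall u i j, i != j -> u i = u j -> f u = 0.

Definition kills k (f : ('I_k -> V) -> R) (r : V) : Prop :=
  forall u i, u i = r -> f u = 0.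

Lemma upd_id k (u : 'I_k -> V) i : upd u i (u i) = u.
Proof. by rewrite funeqE => j; rewrite /upd; case: eqP => [->|]. Qed.

Lemma multilinear_sum k (f : ('I_k -> V) -> R) u i m (c : 'I_m -> R)
    (x : 'I_m -> V) : multilinear f ->
  f (upd u i (\sum_j c j *: x j)) = \sum_j c j * f (upd u i (x j)).
Proof.
move=> fl; have f0 : f (upd u i 0) = 0.
  have := fl u i 1 0 0; rewrite scaler0 addr0 mul1r => /eqP.
  by rewrite -subr_eq subrr eq_sym => /eqP.
elim: m c x => [|m IH] c x; first by rewrite !big_ord0.
by rewrite !big_ord_recl fl IH.
Qed.

Lemma alternate_combination k (f : ('I_k -> V) -> R) u i (c : 'I_k -> R) :
  multilinear f -> alternate f ->
  f (upd u i (\sum_j c j *: u j)) = c i * f u.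
Proof.
move=> fl fa; rewrite multilinear_sum// (bigD1 i)//= upd_id big1 ?addr0// => j ji.
rewrite (fa _ i j) ?mulr0//; first by rewrite eq_sym.
by rewrite /upd eqxx (negbTE ji).
Qed.

(** Composing the summation permutation with [tperm i j] flips every sign and leaves the arguments
    unchanged because [u i = u j], so the sum equals its opposite. *)
Lemma wedge_alternate k l (a : ('I_k -> V) -> R) (b : ('I_l -> V) -> R) :
  alternate (wedge a b).
Proof.
move=> u i j ij uij; rewrite /wedge; set S := \sum_s _.
suff -> : S = 0 by rewrite mulr0.
suff S2 : S = - S.
  by apply/eqP; rewrite -[_ == _](mulrn_eq0 S 2) mulr2n {2}S2 subrr.
rewrite {1}/S (reindex_inj (mulIg (tperm i j))) /= -sumrN; apply: eq_bigr => s _.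
have ut p : u ((s * tperm i j)%g p) = u (s p).
  by rewrite permM; case: tpermP => [->|->|].
rewrite odd_permM odd_tperm ij addbT signrN !mulNr; congr (- (_ * _ * _)).
  by congr a; rewrite funeqE.
by congr b; rewrite funeqE.
Qed.

Lemma upd_inj m k (g : 'I_m -> 'I_k) (u : 'I_k -> V) q x : injective g ->
  (fun p => upd u (g q) x (g p)) = upd (fun p => u (g p)) q x.
Proof. by move=> gI; rewrite funeqE => p; rewrite /upd (inj_eq gI). Qed.

Lemma upd_out m k (g : 'I_m -> 'I_k) (u : 'I_k -> V) i x :
  (forall p, g p != i) -> (fun p => upd u i x (g p)) = (fun p => u (g p)).
Proof. by move=> gi; rewrite funeqE => p; rewrite /upd (negbTE (gi p)). Qed.

(** For each permutation [s], the slot [i] feeds exactly one of the two factors, according to the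
    block containing [s^-1 i]; the other factor does not see the change. *)
Lemma wedge_multilinear k l (a : ('I_k -> V) -> R) (b : ('I_l -> V) -> R) :
  multilinear a -> multilinear b -> multilinear (wedge a b).
Proof.
move=> la lb u i c x y; rewrite /wedge mulrCA -mulrDr; congr (_ * _).
rewrite mulr_sumr -big_split; apply: eq_bigr => s _ /=.
have lI : injective (fun p => s (lshift l p)) by move=> p q /perm_inj/lshift_inj.
have rI : injective (fun p => s (rshift k p)) by move=> p q /perm_inj/rshift_inj.
case: (split_ordP ((s^-1)%g i)) => q /(congr1 s); rewrite permKV => ->.
  have ou z : (fun p => upd u (s (lshift l q)) z (s (rshift k p))) =
      (fun p => u (s (rshift k p))).
    by apply: upd_out => p; rewrite (inj_eq perm_inj) eq_rlshift.
  rewrite !ou !(upd_inj _ _ _ lI) la mulrDr mulrDl.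
  by congr (_ + _); rewrite mulrCA !mulrA.
have ou z : (fun p => upd u (s (rshift k q)) z (s (lshift l p))) =
    (fun p => u (s (lshift l p))).
  by apply: upd_out => p; rewrite (inj_eq perm_inj) eq_lrshift.
by rewrite !ou !(upd_inj _ _ _ rI) lb mulrDr; congr (_ + _); rewrite mulrCA.
Qed.

Lemma wedge_kills k l (a : ('I_k -> V) -> R) (b : ('I_l -> V) -> R) r :
  kills a r -> kills b r -> kills (wedge a b) r.
Proof.
move=> ka kb u i uir; rewrite /wedge big1 ?mulr0// => s _.
case: (split_ordP ((s^-1)%g i)) => q /(congr1 s); rewrite permKV => iE.
  by rewrite (ka _ q) ?mulr0 ?mul0r// -iE.
by rewrite (kb _ q) ?mulr0// -iE.
Qed.

End MultilinearForms.

Section Pairing.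
Variable R : realType.

Lemma pair_mxE m (p v : 'rV[R]_m) : pair_mx p v = (p *m v^T) 0 0.
Proof. by rewrite mxE; apply: eq_bigr => i _; rewrite mxE. Qed.

Lemma pair_mxC m (p v : 'rV[R]_m) : pair_mx p v = pair_mx v p.
Proof. by apply: eq_bigr => i _; rewrite mulrC. Qed.

Lemma pair_mx_scale m (p v : 'rV[R]_m) m' (q : 'rV[R]_m') :
  pair_mx p v *: q = v *m p^T *m q.
Proof.
rewrite [v *m _]mx11_scalar mul_scalar_mx; congr (_ *: _).
by rewrite mxE; apply: eq_bigr => i _; rewrite mxE mulrC.
Qed.

Lemma pair_mxZl m (c : R) (u v : 'rV[R]_m) : pair_mx (c *: u) v = c * pair_mx u v.
Proof. by rewrite /pair_mx mulr_sumr; apply: eq_bigr => i _; rewrite mxE mulrA. Qed.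

Lemma pair_mxDl m (u u' v : 'rV[R]_m) :
  pair_mx (u + u') v = pair_mx u v + pair_mx u' v.
Proof. by rewrite /pair_mx -big_split; apply: eq_bigr => i _; rewrite mxE mulrDl. Qed.

Lemma pair_mx0l m (v : 'rV[R]_m) : pair_mx 0 v = 0.
Proof. by rewrite /pair_mx big1// => i _; rewrite mxE mul0r. Qed.

Lemma pair_mx0r m (u : 'rV[R]_m) : pair_mx u 0 = 0.
Proof. by rewrite pair_mxC pair_mx0l. Qed.

Lemma pair_row_mx m l (a c : 'rV[R]_m) (b d : 'rV[R]_l) :
  pair_mx (row_mx a b) (row_mx c d) = pair_mx a c + pair_mx b d.
Proof. by rewrite !pair_mxE tr_row_mx mul_row_col mxE. Qed.

Lemma pair_mx_suml m l (c : 'I_l -> R) (x : 'I_l -> 'rV[R]_m) (u : 'rV[R]_m) :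
  pair_mx (\sum_i c i *: x i) u = \sum_i c i * pair_mx (x i) u.
Proof.
rewrite pair_mxE mulmx_suml summxE; apply: eq_bigr => i _.
by rewrite -scalemxAl mxE -pair_mxE.
Qed.

Lemma pair_mx_eq0 m (u : 'rV[R]_m) : pair_mx u u = 0 -> u = 0.
Proof.
move=> /eqP; rewrite psumr_eq0 => [/allP uu|i _]; last by rewrite -expr2 sqr_ge0.
apply/rowP => i; rewrite mxE; apply/eqP.
by have := uu i (mem_index_enum _); rewrite mulf_eq0 orbb.
Qed.

Lemma pair_mx_inj m (u u' : 'rV[R]_m) :
  (forall v, pair_mx u v = pair_mx u' v) -> u = u'.
Proof.
move=> E; apply/eqP; rewrite -subr_eq0; apply/eqP/pair_mx_eq0.
rewrite pair_mxDl -scaleN1r pair_mxZl E; ring.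
Qed.

End Pairing.

(** * Reeb vector, invertibility of [flat], and dimension of a Legendrian subspace *)

Section ContactAlgebra.
Variables (R : realType) (n : nat).
Local Notation d := (n * 2 + 1)%N.
Variables (w : 'rV[R]_d -> 'rV[R]_d -> R) (eta : 'rV[R]_d).
Hypothesis w_lin : forall u v v' a, w (a *: u + v) v' = a * w u v' + w v v'.
Hypothesis w_skew : forall u v, w u v = - w v u.
Hypothesis w_vol : exists v : 'I_d -> 'rV[R]_d,
  wedge (@wedge_pow2 R _ (fun u => w (u 0) (u 1)) n)
        (fun u : 'I_1 -> _ => pair_mx eta (u 0)) v != 0.

Let wf (u : 'I_2 -> 'rV[R]_d) := w (u 0) (u 1).
Let ef (u : 'I_1 -> 'rV[R]_d) := pair_mx eta (u 0).

Lemma wf_multilinear : multilinear wf.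
Proof.
move=> u i a x y; rewrite /wf /upd; case: i => -[|[|//]] i; rewrite /= ?w_lin//.
by rewrite w_skew w_lin opprD -mulrN -!w_skew.
Qed.

Lemma ef_multilinear : multilinear ef.
Proof.
move=> u i a x y; rewrite /ef /upd ord1 eqxx !pair_mxE linearP /= mulmxDr.
by rewrite -scalemxAr !mxE.
Qed.

Lemma wedge_pow2_multilinear m : multilinear (@wedge_pow2 R _ wf m).
Proof.
elim: m => [|m IH]; first by move=> u [].
exact: (wedge_multilinear wf_multilinear IH).
Qed.

Lemma wedge_pow2_kills m r : kills wf r -> kills (@wedge_pow2 R _ wf m) r.
Proof.
move=> kr; elim: m => [|m IH]; first by move=> u [].
exact: wedge_kills.
Qed.

(** Such a [u] is killed by the volume form, an alternating form of top degree. Some nontrivial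
    combination of the vectors [v i] equals 0 or [u], according to whether they are dependent or a
    basis. Substituting it for a [v i] of nonzero coefficient multiplies the value by that
    coefficient and also makes it vanish, so the form is zero on [v]. *)
Lemma contact_kernel u : (forall v, w u v = 0) -> pair_mx eta u = 0 -> u = 0.
Proof.
move=> wu eu; apply: contrapT => /eqP u0.
case: w_vol => v; set f := wedge _ _ => /eqP; apply.
have fl : multilinear f.
  by apply: wedge_multilinear;
    [exact: wedge_pow2_multilinear|exact: ef_multilinear].
have fa : alternate f by exact: wedge_alternate.
have kill_u : kills f u.
  apply: wedge_kills => [|z i]; last by rewrite ord1 => ->.
  apply: wedge_pow2_kills => z; case=> -[|[|//]] i zi; rewrite /wf.
    by rewrite (_ : 0 = Ordinal i) ?zi//; exact: val_inj.
  by rewrite w_skew (_ : 1 = Ordinal i) ?zi ?wu ?oppr0//; exact: val_inj.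
have kill_0 : kills f 0.
  move=> z i zi; rewrite -(upd_id z i) zi.
  by have := @multilinear_sum _ _ _ f z i 0 (fun=> 0) (fun=> 0) fl; rewrite !big_ord0.
pose A : 'M[R]_d := \matrix_i v i.
have [c c0 cA] : exists2 c : 'rV[R]_d, c != 0 & c *m A = 0 \/ c *m A = u.
  have [Au|/negP] := boolP (A \in unitmx).
    exists (u *m invmx A); last by right; rewrite mulmxKV.
    apply: contra_neq u0 => uA; by rewrite -[u](mulmxKV Au) uA mul0mx.
  rewrite -row_free_unit -kermx_eq0 => /negP/rowV0Pn[c /sub_kermxP cA c0].
  by exists c => //; left.
have [i ci] : exists i, c 0 i != 0 by apply/rV0Pn.
apply: (mulfI ci); rewrite mulr0 -(alternate_combination v i (fun j => c 0 j))//.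
have -> : \sum_j c 0 j *: v j = c *m A.
  by rewrite mulmx_sum_row; apply: eq_bigr => j _; rewrite rowK.
have uE x : upd v i x i = x by rewrite /upd eqxx.
by case: cA => ->; [apply: (kill_0 _ i)|apply: (kill_u _ i)].
Qed.

(* A skew matrix of odd size is singular; a kernel vector on which [eta] vanished
   would contradict [contact_kernel]. *)
Lemma contact_reeb : exists r, pair_mx eta r = 1 /\ forall v, w r v = 0.
Proof.
pose W : 'M[R]_d := \matrix_(i, j) w (delta_mx 0 i) (delta_mx 0 j).
have w0l v : w 0 v = 0.
  have := w_lin 0 0 v 1; rewrite scaler0 addr0 mul1r => /eqP.
  by rewrite -subr_eq subrr eq_sym => /eqP.
have w_suml m (x : 'I_m -> 'rV[R]_d) (c : 'I_m -> R) v :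
    w (\sum_i c i *: x i) v = \sum_i c i * w (x i) v.
  elim: m x c => [|m IH] x c; first by rewrite !big_ord0.
  by rewrite !big_ord_recl w_lin IH.
have wE r v : w r v = \sum_j (r *m W) 0 j * v 0 j.
  rewrite {1}(row_sum_delta r) w_suml.
  under eq_bigr do rewrite w_skew {1}(row_sum_delta v) w_suml.
  under [RHS]eq_bigr do rewrite mxE mulr_suml.
  rewrite exchange_big; apply: eq_bigr => i _ /=.
  rewrite -sumrN mulr_sumr; apply: eq_bigr => j _.
  by rewrite mxE (w_skew (delta_mx 0 i)) !mulrN mulNr [v 0 j * _]mulrC mulrA.
have Wsk : W^T = - W by apply/matrixP => i j; rewrite !mxE w_skew.
have detW : \det W = 0.
  have := det_tr W; rewrite Wsk -scaleN1r detZ -signr_odd oddD oddM andbF expr1.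
  rewrite mulN1r => /eqP.
  by rewrite eq_sym -subr_eq0 opprK -mulr2n mulrn_eq0 => /eqP.
have /rowV0Pn[r /sub_kermxP rW r0] : kermx W != 0.
  by rewrite kermx_eq0 row_free_unit unitmxE detW unitr0.
have wr v : w r v = 0 by rewrite wE rW big1// => j _; rewrite mxE mul0r.
have er : pair_mx eta r != 0.
  by apply: contra_neq r0 => er; apply: contact_kernel.
exists ((pair_mx eta r)^-1 *: r); split.
  rewrite pair_mxE linearZ /= -scalemxAr mxE -pair_mxE mulVf//.
move=> v; have := w_lin r 0 v (pair_mx eta r)^-1.
by rewrite addr0 wr w0l mulr0 addr0.
Qed.

Definition flat_mx : 'M[R]_d :=
  \matrix_(i, j) w (delta_mx 0 i) (delta_mx 0 j) + eta^T *m eta.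

Lemma form_sumr (v u : 'rV[R]_d) : \sum_i w v (delta_mx 0 i) * u 0 i = w v u.
Proof.
rewrite w_skew [in RHS](row_sum_delta u).
elim/big_rec2: _ => [|i x y _ ->]; last first.
  by rewrite w_lin opprD (w_skew v (delta_mx 0 i)) mulNr mulrC.
have := w_lin 0 0 v 1; rewrite scaler0 addr0 mul1r => /eqP.
by rewrite -subr_eq subrr => /eqP <-; rewrite oppr0.
Qed.

Lemma flat_mxE v :
  \row_i w v (delta_mx 0 i) + pair_mx eta v *: eta = v *m flat_mx.
Proof.
rewrite /flat_mx mulmxDr pair_mx_scale mulmxA; congr (_ + _).
apply/rowP => j; rewrite !mxE w_skew -form_sumr -sumrN; apply: eq_bigr => i _.
by rewrite mxE w_skew mulNr opprK mulrC.
Qed.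

Lemma pair_flat v u : pair_mx (v *m flat_mx) u = w v u + pair_mx eta v * pair_mx eta u.
Proof.
rewrite -form_sumr [pair_mx eta u]/pair_mx mulr_sumr -big_split /=.
by apply: eq_bigr => i _; rewrite -flat_mxE !mxE mulrDl mulrA.
Qed.

(** Pairing [flat v = 0] with the Reeb vector gives [eta v = 0]; what remains says that [w v]
    vanishes, and then [contact_kernel] applies. *)
Lemma flat_mx_unit : flat_mx \in unitmx.
Proof.
have [r [er wr]] := contact_reeb.
rewrite -row_free_unit -kermx_eq0; apply/rowV0P => v /sub_kermxP vF.
have ev : pair_mx eta v = 0.
  by have := pair_flat v r; rewrite vF pair_mx0l er w_skew wr oppr0 add0r mulr1.
apply: contact_kernel => // u.
by have := pair_flat v u; rewrite vF pair_mx0l ev mul0r addr0.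
Qed.

(* [b |-> sh b - b(r) r] has kernel spanned by [eta], which annihilates [range T];
   counting dimensions, [k = (2n + 1 - k) - 1]. *)
Lemma legendrian_subspace k (T : {linear 'rV[R]_k -> 'rV[R]_d})
    (sh : 'rV[R]_d -> 'rV[R]_d) (r : 'rV[R]_d) :
  injective T -> pair_mx eta r = 1 -> (forall v, w r v = 0) ->
  (forall a, sh a *m flat_mx = a) ->
  range T = (fun a => sh a - pair_mx a r *: r) @` annihilator (range T) ->
  (forall v, pair_mx eta (T v) = 0) /\ k = n.
Proof.
move=> Tinj er wr shK TE.
(* Pairing [flat (sh a) = a] with [r] leaves [eta (sh a)], since [r] is in the kernel of [w]. Hence
   [sh a - a(r) r] lies in the kernel of [eta]. *)
have sh_eta a : pair_mx eta (sh a) = pair_mx a r.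
  by rewrite -{2}[a]shK pair_flat er mulr1 w_skew wr oppr0 add0r.
have etaT v : pair_mx eta (T v) = 0.
  have [a _ <-] : ((fun a => sh a - pair_mx a r *: r) @` annihilator (range T)) (T v).
    by rewrite -TE; exists v.
  rewrite pair_mxE linearB /= mulmxBr linearZ /= -scalemxAr !mxE.
  rewrite [X in X - _](_ : _ = pair_mx eta (sh a)); last first.
    by apply: eq_bigr => i _; rewrite mxE.
  rewrite [X in _ - _ * X](_ : _ = pair_mx eta r); last first.
    by apply: eq_bigr => i _; rewrite mxE.
  by rewrite sh_eta er mulr1 subrr.
split=> //.
pose Tm := lin1_mx T; pose K := kermx Tm^T.
pose S := invmx flat_mx - r^T *m r.
have FU := flat_mx_unit.
have shS a : sh a - pair_mx a r *: r = a *m S.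
  rewrite /S mulmxBr -{3}[a]shK mulmxK// mulmxA; congr (_ - _).
  by rewrite -pair_mx_scale pair_mxC.
have annK a : annihilator (range T) a <-> (a <= K)%MS.
  split=> [aT|/sub_kermxP aT _ [v _ <-]].
    apply/sub_kermxP/rowP => j; rewrite !mxE -[RHS](aT (T (delta_mx 0 j))).
      by apply: eq_bigr => i _; rewrite !mxE.
    by exists (delta_mx 0 j).
  by rewrite pair_mxE -(mul_rV_lin1 T) trmx_mul mulmxA aT mul0mx mxE.
have rkT : \rank Tm = k.
  apply/eqP; rewrite -[_ == _]/(row_free Tm) -kermx_eq0; apply/rowV0P => v /sub_kermxP.
  by rewrite mul_rV_lin1 -(linear0 T) => /Tinj.
have TS : (Tm :=: K *m S)%MS.
  apply/eqmxP/andP; split; apply/row_subP => i.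
    have : range T (row i Tm) by exists (delta_mx 0 i) => //; rewrite rowE mul_rV_lin1.
    rewrite TE => -[a /annK aK <-]; rewrite shS; exact: submxMr.
  rewrite row_mul -shS; have : range T (sh (row i K) - pair_mx (row i K) r *: r).
    by rewrite TE; exists (row i K) => //; apply/annK; exact: row_sub.
  by case=> v _ <-; rewrite -(mul_rV_lin1 T); exact: submxMl.
have r_flat : r *m flat_mx = eta.
  rewrite -flat_mxE er scale1r [X in X + _](_ : _ = 0) ?add0r//.
  by apply/rowP => i; rewrite !mxE wr.
have eta_inv : eta *m invmx flat_mx = r by rewrite -r_flat mulmxK.
have KS : (K :&: kermx S :=: eta)%MS.
  apply/eqmxP/andP; split.
    apply/rV_subP => a; rewrite sub_capmx => /andP[_ /sub_kermxP].
    rewrite -shS => /eqP; rewrite subr_eq0 => /eqP /(congr1 (mulmx^~ flat_mx)).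
    by rewrite shK -scalemxAl r_flat => ->; exact: scalemx_sub.
  rewrite sub_capmx; apply/andP; split.
    by apply/annK => _ [v _ <-].
  apply/sub_kermxP; rewrite /S mulmxBr eta_inv mulmxA -pair_mx_scale.
  by rewrite pair_mxC er scale1r subrr.
have eta0 : eta != 0.
  apply: contra_eqN er => /eqP ->.
  by rewrite pair_mx0l eq_sym oner_eq0.
have := mxrank_mul_ker K S; rewrite KS rank_rV eta0 -TS rkT mxrank_ker mxrank_tr rkT.
(* This bound makes the truncated subtraction in the rank of the annihilator exact. *)
have : (k <= d)%N by rewrite -rkT rank_leq_col.
move=> kd /(congr1 (addn k)); rewrite subnKC// addnA => /addIn.
by rewrite addnn -mul2n mulnC => /eqP; rewrite eqn_pmul2r// => /eqP.
Qed.

End ContactAlgebra.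

(** * Existence of an invertible slope *)

Section GenericSlope.
Variable R : realType.

(* Vectors [v] with [v P = t v Q] for distinct [t] have orthogonal, nonzero images
   [v Q], so at most [n] values of [t] make [P - t Q] singular. *)
Lemma generic_slope n (P Q : 'M[R]_n) :
  (forall u v : 'rV[R]_n, pair_mx (u *m P) (v *m Q) = pair_mx (v *m P) (u *m Q)) ->
  (forall v : 'rV[R]_n, v *m Q = 0 -> v *m P = 0 -> v = 0) ->
  exists t : R, P - t *: Q \in unitmx.
Proof.
move=> sym imm; apply: contrapT => sing.
(* The test values are the integers [0, ..., n], distinct in [R]: one more than the number of
   nonzero pairwise orthogonal rows of length [n]. *)
have /choice[v vP] (i : 'I_n.+1) : exists v : 'rV[R]_n,
    v != 0 /\ v *m P = i%:R *: (v *m Q).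
  have : P - i%:R *: Q \notin unitmx by apply/negP => U; apply: sing; exists i%:R.
  rewrite -row_free_unit -kermx_eq0 => /rowV0Pn[v /sub_kermxP vK v0].
  exists v; split=> //; apply/eqP.
  by rewrite -subr_eq0 scalemxAr -mulmxBr vK.
have vQ0 i : v i *m Q != 0.
  have [v0 viP] := vP i; apply: contra_neq v0 => vQ; apply: imm => //.
  by rewrite viP vQ scaler0.
have ortho i j : i != j -> pair_mx (v i *m Q) (v j *m Q) = 0.
  move=> ij; have := sym (v i) (v j).
  rewrite (vP i).2 (vP j).2 !pair_mxZl (pair_mxC (v j *m Q)) => /eqP.
  rewrite -subr_eq0 -mulrBl mulf_eq0 subr_eq0 eqr_nat => /orP[/eqP E|/eqP//].
  by move/eqP: ij; case; exact: val_inj.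
pose G : 'M[R]_(n.+1, n) := \matrix_i (v i *m Q).
have : kermx G != 0.
  by rewrite kermx_eq0; apply/negP => /eqP rG; have := rank_leq_col G; rewrite rG ltnn.
case/rowV0Pn => c /sub_kermxP cG; case/rV0Pn => j; apply/negP; rewrite negbK.
have : pair_mx (c *m G) (v j *m Q) = 0.
  by rewrite cG pair_mx0l.
rewrite mulmx_sum_row pair_mx_suml (bigD1 j)//= big1 => [|i ij].
  rewrite addr0 rowK => /eqP; rewrite mulf_eq0 => /orP[//|/eqP/pair_mx_eq0 vj].
  by have := vQ0 j; rewrite vj eqxx.
by rewrite rowK ortho ?mulr0.
Qed.

End GenericSlope.

(** * Charts and tangent maps *)

Section Charts.
Variable R : realType.

Lemma open_setI_preimage (V W : normedModType R) (O : set V) (O' : set W)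
    (f : V -> W) : open O -> open O' -> (forall x, O x -> {for x, continuous f}) ->
  open (O `&` f @^-1` O').
Proof.
move=> oO oO' cf; rewrite openE => x [Ox O'fx]; apply: filterI.
  exact: open_nbhs_nbhs.
by apply: cf => //; exact: open_nbhs_nbhs.
Qed.

Lemma smooth_continuous (V W : normedModType R) (O : set V) (f : V -> W) x :
  smooth_on O f -> O x -> {for x, continuous f}.
Proof. by move=> /(_ 0%N); exact. Qed.

Lemma smooth_differentiable (V W : normedModType R) (O : set V) (f : V -> W) x :
  smooth_on O f -> O x -> differentiable f x.
Proof. by move=> /(_ 1%N)[df _]; exact: df. Qed.

Lemma alongE (X : Type) n (T : zmodType) (D : set X) (c : X -> 'rV[R]_n)
    (f : X -> T) x : {in D &, injective c} -> D x -> along D c f (c x) = f x.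
Proof.
move=> cI Dx; rewrite /along.
have [|y [Dy /cI cyx] <-] := @xgetPex _ 0 (f @` [set x0 | D x0 /\ c x0 = c x]).
  by exists (f x); exists x.
by rewrite cyx// inE.
Qed.

Lemma chart_inj n (X : atlas R n) (i : idx X) x y : {in dom i &, injective (crd i)} ->
  dom i x -> dom i y -> crd i x = crd i y -> x = y.
Proof. by move=> cI ix iy /cI; apply; rewrite inE. Qed.

Lemma inchartE n (X : atlas R n) (T : zmodType) (i : idx X) (f : X -> T) x :
  {in dom i &, injective (crd i)} -> dom i x -> inchart i f (crd i x) = f x.
Proof. exact: alongE. Qed.

Lemma manifold_inj n (X : atlas R n) (i : idx X) : manifold X ->
  {in dom i &, injective (crd i)}.
Proof. by case=> _ /(_ i)[]. Qed.

Section Maps.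
Variables (m n : nat) (X : atlas R m) (Y : atlas R n).

(** Spelled exactly as the open set in [smooth_map setT f], factor [setT] included, so that openness
    and smoothness are read off by conversion. *)
Definition chart_dom (f : X -> Y) (i : idx X) (j : idx Y) :=
  crd i @` (setT `&` dom i `&` f @^-1` dom j).

Lemma chart_domE (f : X -> Y) (i : idx X) (j : idx Y) x :
  {in dom i &, injective (crd i)} -> dom i x ->
  chart_dom f i j (crd i x) -> dom j (f x).
Proof. by move=> cI ix [x' [[_ ix'] jx'] /(chart_inj cI ix' ix) <-]. Qed.

Lemma near_chart_dom (f : X -> Y) (i : idx X) (j : idx Y) x :
  smooth_map setT f -> dom i x -> dom j (f x) ->
  \forall u \near crd i x, chart_dom f i j u.
Proof.
move=> sf ix jfx; apply: open_nbhs_nbhs; split; first exact: (sf i j).1.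
by exists x.
Qed.

Lemma chart_differentiable (f : X -> Y) (i : idx X) (j : idx Y) x :
  smooth_map setT f -> dom i x -> dom j (f x) ->
  differentiable (inchart i (crd j \o f)) (crd i x).
Proof.
move=> sf ix jfx; apply: smooth_differentiable (sf i j).2 _.
by exists x.
Qed.

End Maps.

Lemma tmap_comp m n p (X : atlas R m) (Y : atlas R n) (Z : atlas R p)
    (f : X -> Y) (g : Y -> Z) (i : idx X) (j : idx Y) (l : idx Z) x :
  {in dom i &, injective (crd i)} -> {in dom j &, injective (crd j)} ->
  smooth_map setT f -> smooth_map setT g ->
  dom i x -> dom j (f x) -> dom l (g (f x)) -> forall v,
  tmap (g \o f) x i l v = tmap g (f x) j l (tmap f x i j v).
Proof.
move=> iI jI sf sg ix jfx lgfx v; rewrite /tmap.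
have fx : inchart i (crd j \o f) (crd i x) = crd j (f x) by rewrite inchartE.
rewrite -fx.
have -> : 'd (inchart i (crd l \o (g \o f))) (crd i x) =
    'd (inchart j (crd l \o g) \o inchart i (crd j \o f)) (crd i x) :> (_ -> _).
  apply: near_diff; apply: filterS (near_chart_dom sf ix jfx) => _ [y [[_ iy] jfy] <-].
  by rewrite /= !inchartE.
rewrite diff_comp//; first exact: chart_differentiable.
by rewrite fx; exact: chart_differentiable.
Qed.

Lemma tmap_id n (X : atlas R n) (i : idx X) x v : manifold X -> dom i x ->
  tmap (@id X) x i i v = v.
Proof.
move=> mX ix; rewrite /tmap.
have [_ /(_ i)[iI /(_ i) ii] _ _] := mX; have [oi _ _ _] := ii.
rewrite (@near_diff _ _ _ _ id); last first.
  have : \forall u \near crd i x, (crd i @` (dom i `&` dom i)) u.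
    by apply: open_nbhs_nbhs; split=> //; exists x.
  by apply: filterS => _ [y [iy _] <-]; rewrite inchartE.
by rewrite -deriveE// derive_id.
Qed.

(** The transformation law propagates the components from one chart to all charts at [x], and in the
    remaining charts they are normalised to 0. This yields the injectivity of the charts of the
    cotangent bundle. *)
Lemma covec_eq n (X : atlas R n) (x : X) (i : idx X) (c c' : covec x) :
  dom i x -> c i = c' i -> c = c'.
Proof.
case: c c' => [p [pi p0]] [p' [p'i p'0]] /= ix E.
have pp' : p = p'.
  rewrite funeqE => j; have [jx|jx] := pselect (dom j x); last by rewrite p0// p'0.
  apply/rowP => l.
  have dl (q : 'rV[R]_n) : q 0 l = pair_mx q (delta_mx 0 l).
    rewrite /pair_mx (bigD1 l)//= big1 => [|k kl].
      by rewrite mxE !eqxx addr0 mulr1.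
    by rewrite mxE (negbTE kl) andbF mulr0.
  by rewrite !dl (pi j i)// (p'i j i)// E.
by subst p'; congr Covec; exact: Prop_irrelevance.
Qed.

Lemma ecot_chart_inj n (Q : atlas R n) (j : idx (ecot Q)) : manifold Q ->
  {in dom j &, injective (crd j)}.
Proof.
case: j => j [] mQ [[q c] z] [[q' c'] z']; rewrite !inE => -[/= jq _] [/= jq' _].
move=> /eq_row_mx[/eq_row_mx[/(chart_inj (manifold_inj mQ) jq jq') qq' cc'] zz'].
subst q'; have -> := covec_eq jq cc'; congr (_, _).
by have := congr1 (fun u : 'rV_1 => u 0 0) zz'; rewrite !mxE.
Qed.

End Charts.

(** * Open subsets of Euclidean space as manifolds with one chart *)

Section OpenSubsets.
Variables (R : realType) (d : nat) (O : set 'rV[R]_d).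
Hypothesis oO : open O.

Definition open_atlas : atlas R d :=
  @Atlas R d {x : 'rV[R]_d | O x} unit (fun=> setT) (fun=> sval).

Implicit Types x y : {x : 'rV[R]_d | O x}.

Lemma open_atlas_inj x y : sval x = sval y -> x = y.
Proof.
case: x y => [x xO] [y yO] /= xy; subst y; congr exist; exact: Prop_irrelevance.
Qed.

Lemma open_crd_inj (i : idx open_atlas) : {in dom i &, injective (crd i)}.
Proof. by move=> x y _ _; exact: open_atlas_inj. Qed.

Lemma inchart_open (T : zmodType) (f : open_atlas -> T) (i : idx open_atlas) u
  (uO : O u) : inchart i f u = f (exist _ u uO).
Proof. exact: (@inchartE _ _ _ T i f (exist _ u uO) (open_crd_inj (i := i))). Qed.

Lemma open_crd_image (A : set 'rV[R]_d) :
  sval @` [set x : {x | O x} | A (sval x)] = O `&` A.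
Proof.
apply/seteqP; split=> [_ [[x xO] Ax <-]//|x [xO Ax]].
by exists (exist _ x xO).
Qed.

Lemma open_crd_image_setT (A : set {x | O x}) :
  (forall x, A x) -> (sval @` A : set 'rV[R]_d) = O.
Proof.
move=> AT; rewrite -[RHS]setIT -open_crd_image; congr (_ @` _).
by apply/seteqP; split=> // x _; exact: AT.
Qed.

Lemma mopen_preimage (A : set 'rV[R]_d) : open A -> @mopen R d open_atlas (sval @^-1` A).
Proof.
move=> oA i; rewrite (_ : _ `&` _ = [set x | A (sval x)]); last first.
  by apply/seteqP; split=> [x []|x].
by rewrite open_crd_image; exact: openI.
Qed.

(** Supplies the countable base of a manifold. A radius below [e / 2] keeps a ball that contains [u]
    inside the ball of radius [e] about [u]; a rational centre is found coordinate by coordinate. *)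
Lemma rational_ball (W : set 'rV[R]_d) (u : 'rV[R]_d) : open W -> W u ->
  exists (q : 'rV[rat]_d) (k : nat), let q' : 'rV[R]_d := map_mx ratr q in
    ball q' k.+1%:R^-1 u /\ ball q' k.+1%:R^-1 `<=` W.
Proof.
move=> oW Wu; have /nbhs_ballP[e /= e0 eW] := open_nbhs_nbhs (conj oW Wu).
have e20 : 0 < e / 2 by exact: divr_gt0.
have [k _ /(_ k (leqnn k)) /= ke] := near_infty_natSinv_lt (PosNum e20).
have k0 : 0 < k.+1%:R^-1 :> R by rewrite invr_gt0.
have /choice[q qP] (i : 'I_d) : exists q : rat, `|ratr q - u 0 i| < k.+1%:R^-1 :> R.
  have [|q] := @rat_in_itvoo R (u 0 i) (u 0 i + k.+1%:R^-1); first by rewrite ltrDl.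
  rewrite in_itv /= => /andP[uq qu]; exists q.
  by rewrite gtr0_norm ?subr_gt0// ltrBlDl.
pose q' : 'rV[R]_d := map_mx ratr (\row_i q i).
have qu : ball q' k.+1%:R^-1 u.
  split=> // a i; rewrite ord1 !mxE; exact: qP.
exists (\row_i q i), k; split=> // v qv; apply: eW.
rewrite [e]splitr; apply: ball_triangle (le_ball (ltW ke) qv).
exact/ball_sym/(le_ball (ltW ke)).
Qed.

Lemma manifold_open_atlas : manifold open_atlas.
Proof.
have imT : @crd R d open_atlas tt @` (setT `&` setT) = O :> set 'rV[R]_d.
  by apply: (@open_crd_image_setT (setT `&` setT)).
split.
- by move=> x; exists tt.
- case; split; first exact: (@open_crd_inj tt).
  case; rewrite /= imT; split=> //.
    move=> k; apply: (Ck_on_ext oO _ (Ck_on_id k O)) => u uO.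
    exact/esym/(@inchart_open 'rV[R]_d sval tt u uO).
  move=> k; apply: (Ck_on_ext oO _ (Ck_on_id k O)) => u uO.
  by rewrite inchart_open.
- move=> x y xy; have xy' : sval x <> sval y by move=> /open_atlas_inj.
  have [A [B [oA oB Ax By AB]]] : exists A B : set 'rV[R]_d,
      [/\ open A, open B, A (sval x), B (sval y) & A `&` B = set0].
    have := @norm_hausdorff R 'rV[R]_d; rewrite open_hausdorff => H.
    have /H[[A B] /= [Ax By] [oA oB AB]] : sval x != sval y by apply/eqP.
    by exists A, B; rewrite !inE in Ax By; split=> //; exact/eqP.
  exists (sval @^-1` A), (sval @^-1` B); split=> //; try exact: mopen_preimage.
  by rewrite -preimage_setI AB preimage_set0.
(* The base is enumerated by decoding [m] as a rational centre and a radius; a number that encodes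
   nothing gives the empty set. *)
- pose B m : set {x : 'rV[R]_d | O x} :=
    if @unpickle ('rV[rat]_d * nat)%type m is Some (q, k)
    then sval @^-1` ball (map_mx ratr q : 'rV[R]_d) k.+1%:R^-1 else set0.
  exists B; split=> [m|A oA x Ax].
    rewrite /B; case: unpickle => [[q k]|].
      by apply: mopen_preimage; apply: ball_open; rewrite invr_gt0.
    by move=> i; rewrite set0I image_set0; exact: open0.
  have [||q [k [qx qA]]] :=
    @rational_ball (@crd R d open_atlas tt @` (A `&` setT)) (sval x).
  + exact: oA tt.
  + by exists x.
  exists (pickle (q, k)); rewrite /B pickleK; split=> // y /= /qA[z [Az _]].
  by move=> /open_atlas_inj <-.
Qed.

End OpenSubsets.

(** * The generating family in coordinates *)

Section LegendrianData.
Variables (R : realType) (n : nat) (O : set 'rV[R]_n).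
Variables (q p : 'rV[R]_n -> 'rV[R]_n) (z : 'rV[R]_n -> R).
Hypotheses (oO : open O) (sq : smooth_on O q) (sp : smooth_on O p)
  (sz : smooth_on O z).
Hypothesis dz : forall y, O y -> forall v,
  'd (z : _ -> R^o) y v = pair_mx (p y) ('d q y v).

Lemma diff_coord m (f : 'rV[R]_n -> 'rV[R]_m) y v i : differentiable f y ->
  'D_v (fun y => f y 0 i) y = ('d f y v) 0 i.
Proof.
move=> df; rewrite -[in RHS]deriveE// derive_mx ?mxE//.
exact: diff_derivable.
Qed.

Lemma derive_dz v y : O y -> 'D_v z y = \sum_i p y 0 i * 'D_v (fun y => q y 0 i) y.
Proof.
move=> Oy; rewrite deriveE ?dz//; last exact: smooth_differentiable sz Oy.
by apply: eq_bigr => i _; rewrite diff_coord//; exact: smooth_differentiable sq Oy.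
Qed.

Lemma smooth_coord (f : 'rV[R]_n -> 'rV[R]_n) i :
  smooth_on O f -> smooth_on O (fun y => f y 0 i : R).
Proof. by move=> sf k; exact: Ck_on_coord. Qed.

Lemma derive2_dz v w y : O y -> 'D_v ('D_w z) y =
  \sum_i (p y 0 i * 'D_v ('D_w (fun y => q y 0 i)) y +
          'D_w (fun y => q y 0 i) y * 'D_v (fun y => p y 0 i) y).
Proof.
move=> Oy; pose h i := (fun y => p y 0 i) * 'D_w (fun y => q y 0 i).
have dp i : derivable (fun y => p y 0 i : R) y v.
  by apply: diff_derivable; exact: smooth_differentiable (smooth_coord i sp) Oy.
have ddq i : derivable ('D_w (fun y => q y 0 i : R)) y v.
  apply: diff_derivable.
  by have [_ /(_ w)[+ _]] := smooth_coord i sq 2%N; apply.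
have -> : 'D_v ('D_w z) y = 'D_v (\sum_i h i) y.
  apply: near_eq_derive; apply: filterS (open_nbhs_nbhs (conj oO Oy)) => u Ou.
  by rewrite derive_dz// fct_sumE.
rewrite derive_sum; last by move=> i; exact: derivableM.
by apply: eq_bigr => i _; rewrite deriveM.
Qed.

(** Used to discard the terms with second derivatives of [q], which are symmetric by Schwarz. *)
Lemma sum_cancel m (a a' b c : 'I_m -> R) : (forall i, a i = a' i) ->
  \sum_i (a i + b i) = \sum_i (a' i + c i) -> \sum_i b i = \sum_i c i.
Proof.
by move=> aa'; rewrite !big_split /=; under eq_bigr do rewrite aa'; move/addrI.
Qed.

(* Differentiating [dz = p dq] and antisymmetrising: [dp /\ dq] vanishes. *)
Lemma isotropic v w y : O y ->
  pair_mx ('d p y v) ('d q y w) = pair_mx ('d p y w) ('d q y v).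
Proof.
move=> Oy.
have E := etrans (esym (derive2_dz v w Oy))
  (etrans (derive_derive_sym v w oO (sz 2%N) Oy) (derive2_dz w v Oy)).
have dq := smooth_differentiable sq Oy; have dp := smooth_differentiable sp Oy.
have {}E := sum_cancel (fun i => congr1 ( *%R (p y 0 i))
  (derive_derive_sym v w oO (smooth_coord i sq 2%N) Oy)) E.
have pairE a b : pair_mx ('d p y a) ('d q y b) =
    \sum_i 'D_b (fun y => q y 0 i) y * 'D_a (fun y => p y 0 i) y.
  by apply: eq_bigr => i _; rewrite mulrC (diff_coord _ _ dp) (diff_coord _ _ dq).
exact: etrans (pairE v w) (etrans E (esym (pairE w v))).
Qed.

(* The matrix is kept opaque: unification must not unfold ['d]. *)
Lemma diff_mx_exists (f : 'rV[R]_n -> 'rV[R]_n) y :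
  {A : 'M[R]_n | forall v : 'rV[R]_n, v *m A = 'd f y v}.
Proof. by exists (lin1_mx ('d f y)) => v; rewrite mul_rV_lin1. Qed.

Definition diff_mx f y := sval (diff_mx_exists f y).

Lemma mul_diff_mx f (y v : 'rV[R]_n) : v *m diff_mx f y = 'd f y v.
Proof. exact: svalP (diff_mx_exists f y) v. Qed.

Definition slope_mx (t : R) (y : 'rV[R]_n) : 'M[R]_n :=
  diff_mx p y - t *: diff_mx q y.

Lemma mul_slope_mx t (v y : 'rV[R]_n) : v *m slope_mx t y = 'd p y v - t *: 'd q y v.
Proof.
rewrite /slope_mx mulmxBr -scalemxAr.
by congr (_ - _ *: _); exact: mul_diff_mx.
Qed.

Lemma exists_slope y : O y ->
  (forall v, 'd q y v = 0 -> 'd p y v = 0 -> v = 0) ->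
  exists t, slope_mx t y \in unitmx.
Proof.
move=> Oy imm; apply: generic_slope => [u v|v].
  transitivity (pair_mx ('d p y u : 'rV_n) ('d q y v)).
    by congr pair_mx; exact: mul_diff_mx.
  transitivity (pair_mx ('d p y v : 'rV_n) ('d q y u)); first exact: isotropic.
  by congr pair_mx; apply/esym; exact: mul_diff_mx.
move=> qv pv; apply: imm; first exact: etrans (esym (mul_diff_mx q y v)) qv.
exact: etrans (esym (mul_diff_mx p y v)) pv.
Qed.

(** The entries of the matrix are first partial derivatives, so its determinant is smooth on [O] and
    the set where it is nonzero is open. *)
Lemma open_slope_unit t : open [set y | O y /\ slope_mx t y \in unitmx].
Proof.
have sM i j : smooth_on O (fun y => slope_mx t y i j).
  move=> k; have Dp := (smooth_coord j sp k.+1).2 (delta_mx 0 i).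
  have Dq := (smooth_coord j sq k.+1).2 (delta_mx 0 i).
  have Dtq := Ck_onM oO (Ck_on_cst k O (- t)) Dq.
  apply: (Ck_on_ext oO _ (Ck_onD oO Dp Dtq)) => y Oy.
  have dq := smooth_differentiable sq Oy; have dp := smooth_differentiable sp Oy.
  have -> : slope_mx t y i j = ((delta_mx 0 i : 'rV_n) *m slope_mx t y) 0 j.
    by rewrite -rowE [RHS]mxE.
  rewrite (congr1 (fun w : 'rV_n => w 0 j) (mul_slope_mx t _ y)) !mxE -mulNr.
  by congr (_ + _ * _); exact: diff_coord.
have sdet : smooth_on O (fun y => \det (slope_mx t y)).
  move=> k; rewrite /determinant.
  (* [Ck_on_sum] handles sums over ordinals; the sum over permutations is treated by induction on
     the list of its indices. *)
  suff sum_perm (T : seq 'S_n) : Ck_on k O (fun y =>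
      \sum_(s <- T) (-1) ^+ s * \prod_i slope_mx t y i (s i)) by exact: sum_perm.
  elim: T => [|s T IH].
    by under [X in Ck_on _ _ X]eq_fun do rewrite big_nil; exact: Ck_on_cst.
  under [X in Ck_on _ _ X]eq_fun do rewrite big_cons.
  apply: Ck_onD => //; apply: Ck_onM => //; first exact: Ck_on_cst.
  by apply: Ck_on_prod => // i; exact: sM.
have -> : [set y | O y /\ slope_mx t y \in unitmx] =
    O `&` (fun y => \det (slope_mx t y)) @^-1` [set~ 0].
  apply/seteqP; split=> y /= [Oy]; rewrite unitmxE unitfE => /eqP D; split=> //.
apply: open_setI_preimage => //.
  by rewrite openC; exact: closed_eq.
by move=> y Oy; exact: smooth_continuous sdet Oy.
Qed.

End LegendrianData.

(** * The family, its gradient and its critical points *)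

Section GeneratingFamily.
Variables (R : realType) (n : nat) (A O : set 'rV[R]_n).
Variables (q p : 'rV[R]_n -> 'rV[R]_n) (z : 'rV[R]_n -> R) (t : R).
Hypotheses (oA : open A) (oO : open O) (sq : smooth_on O q) (sp : smooth_on O p)
  (sz : smooth_on O z).
Hypothesis dz : forall y, O y -> forall v,
  'd (z : _ -> R^o) y v = pair_mx (p y) ('d q y v).
Hypothesis slopeU : forall y, O y -> slope_mx q p t y \in unitmx.

Definition fam_dom : set 'rV[R]_(n + n) := [set x | A (lsubmx x) /\ O (rsubmx x)].

Definition gap (x : 'rV[R]_(n + n)) : 'rV[R]_n := lsubmx x - q (rsubmx x).

Definition fam (x : 'rV[R]_(n + n)) : R :=
  z (rsubmx x) + pair_mx (p (rsubmx x)) (gap x) + t / 2 * pair_mx (gap x) (gap x).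

(** Gradient of [fam] in blocks (base, fibre). The transpose comes from the row convention: pairing
    [gap *m S^T] with [w] is pairing [gap] with [w *m S]. *)
Definition fam_grad (x : 'rV[R]_(n + n)) : 'rV[R]_(n + n) :=
  row_mx (p (rsubmx x) + t *: gap x) (gap x *m (slope_mx q p t (rsubmx x))^T).

Lemma open_fam_dom : open fam_dom.
Proof.
have -> : fam_dom = lsubmx @^-1` A `&` rsubmx @^-1` O by [].
apply: openI; apply: open_comp => // x _.
  exact: continuous_lsubmx.
exact: continuous_rsubmx.
Qed.

Lemma smooth_comp_rsubmx (f : 'rV[R]_n -> R) : smooth_on O f ->
  smooth_on fam_dom (f \o rsubmx).
Proof.
move=> sf k; apply: (@Ck_on_comp_real _ _ _ _ _ O) (sf k) => //.
- exact: open_fam_dom.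
- by move=> x [].
- by apply: Ck_on_lin; [exact: open_fam_dom|exact: continuous_rsubmx].
Qed.

Lemma smooth_gap i : smooth_on fam_dom (fun x => gap x 0 i).
Proof.
move=> k; have oF := open_fam_dom.
have ql := smooth_comp_rsubmx (smooth_coord oO i sq) k.
have xl : Ck_on k fam_dom (fun x => (lsubmx x : 'rV_n) 0 i : R).
  by apply: Ck_on_coord => //; apply: Ck_on_lin => //; exact: continuous_lsubmx.
apply: (Ck_on_ext oF _ (Ck_onD oF xl (Ck_onM oF (Ck_on_cst k fam_dom (-1 : R)) ql))).
by move=> x _; rewrite /gap !mxE /= mulN1r.
Qed.

Lemma smooth_fam : smooth_on fam_dom fam.
Proof.
move=> k; have oF := open_fam_dom.
apply: Ck_onD => //; first apply: Ck_onD => //.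
- exact: smooth_comp_rsubmx sz k.
- apply: Ck_on_sum => // i; apply: Ck_onM => //; last exact: smooth_gap.
  exact: smooth_comp_rsubmx (smooth_coord oO i sp) k.
- apply: Ck_onM => //; first exact: Ck_on_cst.
  by apply: Ck_on_sum => // i; apply: Ck_onM => //; exact: smooth_gap.
Qed.

Lemma is_derive_comp_rsubmx (f : 'rV[R]_n -> R) (x v : 'rV[R]_(n + n)) (df : R) :
  is_derive (rsubmx x) (rsubmx v) f df -> is_derive x v (f \o rsubmx) df.
Proof.
move=> [dv fE].
have E : (fun h : R => h^-1 *: ((f \o rsubmx) (h *: v + x) - (f \o rsubmx) x)) =
    (fun h : R => h^-1 *: (f (h *: rsubmx v + rsubmx x) - f (rsubmx x))).
  by rewrite funeqE => h /=; rewrite linearP.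
by split; [move: dv|move: fE]; rewrite /derivable /derive /= E.
Qed.

(** One coordinate of the derivative of [fam] in the direction [(u, w)]: [a], [b], [c], [g], [h]
    stand for the coordinates of [p], [dq w], [u], [gap], [dp w]. The first [a * b] is the
    contribution of [dz = p dq]; it cancels the one from differentiating [gap]. *)
Lemma fam_identity (a b c g h : R) :
  a * b + (a * (c - b) + g * h) + t / 2 * (g * (c - b) + g * (c - b)) =
  (a + t * g) * c + g * (h - t * b).
Proof. by field. Qed.

Lemma diff_fam x v : fam_dom x -> 'd (fam : _ -> R^o) x v = pair_mx (fam_grad x) v.
Proof.
move=> Fx; have [_ Oy] := Fx; set y := rsubmx x in Oy.
pose w : 'rV[R]_n := rsubmx v; pose u : 'rV[R]_n := lsubmx v.
have dq := smooth_differentiable sq Oy; have dp := smooth_differentiable sp Oy.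
pose Q := 'd q y w : 'rV_n; pose P := 'd p y w : 'rV_n.
have coordD (f : 'rV[R]_n -> 'rV[R]_n) i : smooth_on O f ->
    is_derive x v (fun x => f (rsubmx x) 0 i : R) (('d f y w : 'rV_n) 0 i).
  move=> sf; apply: (@is_derive_comp_rsubmx (fun y => f y 0 i)).
  split; last by apply: diff_coord; exact: smooth_differentiable sf Oy.
  by apply: diff_derivable; exact: smooth_differentiable (smooth_coord oO i sf) Oy.
have Dz : is_derive x v (z \o rsubmx) (pair_mx (p y) Q).
  apply: is_derive_comp_rsubmx; have dzy := smooth_differentiable sz Oy.
  by split; [exact: diff_derivable|rewrite deriveE// dz].
have Dg i : is_derive x v (fun x => gap x 0 i : R) (u 0 i - Q 0 i).
  have -> : (fun x => gap x 0 i) =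
      (fun x => (lsubmx x : 'rV_n) 0 i) - (fun x => q (rsubmx x) 0 i).
    by rewrite funeqE => x'; rewrite !fctE /gap !mxE.
  apply: is_deriveB; last exact: coordD.
  have dl : differentiable (fun x : 'rV[R]_(n + n) => (lsubmx x : 'rV_n) 0 i : R) x.
    apply: (@differentiable_comp _ _ _ _ lsubmx (fun a : 'rV[R]_n => a 0 i)).
      exact: differentiable_lsubmx.
    exact: differentiable_coord.
  split; first exact: diff_derivable.
  rewrite /derive; have -> : (fun h : R => h^-1 *: ((fun x : 'rV[R]_(n + n) =>
      (lsubmx x : 'rV_n) 0 i : R) (h *: v + x) - (lsubmx x : 'rV_n) 0 i)) =
      (fun h => h^-1 * (h * u 0 i)).
    by rewrite funeqE => h; rewrite /u !mxE addrK.
  apply/lim_near_cst => //; near=> h; rewrite mulKf//.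
  by near: h; exact: nbhs_dnbhs_neq.
have famE : fam = (z \o rsubmx) +
    \sum_i ((fun x => p (rsubmx x) 0 i) * (fun x => gap x 0 i)) +
    (t / 2) *: \sum_i ((fun x => gap x 0 i) * (fun x => gap x 0 i)).
  by rewrite funeqE => x'; rewrite !fctE !fct_sumE.
have D : is_derive x v fam (pair_mx (p y) Q +
    \sum_i (p y 0 i *: (u 0 i - Q 0 i) + gap x 0 i *: P 0 i) +
    (t / 2) *: \sum_i (gap x 0 i *: (u 0 i - Q 0 i) + gap x 0 i *: (u 0 i - Q 0 i))).
  rewrite famE; apply: is_deriveD; first apply: is_deriveD => //.
    by apply: is_derive_sum => i; apply: is_deriveM; exact: coordD.
  by apply: is_deriveZ; apply: is_derive_sum => i; apply: is_deriveM.
rewrite -deriveE; last exact: smooth_differentiable smooth_fam Fx.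
have [_ ->] := D; clear D famE Dg Dz coordD.
have -> : pair_mx (fam_grad x) v = pair_mx (p y + t *: gap x) u +
    pair_mx (gap x) (P - t *: Q).
  rewrite -[v in LHS]hsubmxK /fam_grad pair_row_mx.
  congr (_ + _); rewrite !pair_mxE -[P - _](mul_slope_mx q p t w y).
  by rewrite trmx_mul mulmxA.
rewrite /pair_mx scaler_sumr -!big_split; apply: eq_bigr => i _ /=.
move: P Q u (gap x) (p y) => P' Q' u' g p'; rewrite !mxE; exact: fam_identity.
Unshelve. all: by end_near. Qed.

Lemma fam_critical x : fam_dom x -> rsubmx (fam_grad x) = 0 -> gap x = 0.
Proof.
move=> [_ Oy]; rewrite /fam_grad row_mxKr => g0.
have SU : (slope_mx q p t (rsubmx x))^T \in unitmx by rewrite unitmx_tr slopeU.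
by rewrite -[gap x](mulmxK SU) g0 mul0mx.
Qed.

Lemma fam_gap0 x : gap x = 0 ->
  fam x = z (rsubmx x) /\ fam_grad x = row_mx (p (rsubmx x)) 0.
Proof.
move=> g0; rewrite /fam /fam_grad g0 mul0mx scaler0 addr0; split=> //.
by rewrite !pair_mx0r mulr0 !addr0.
Qed.

(* The graph of the gradient contains straight lines over the base directions,
   which supply the tangent vectors of [im_d] in the Morse condition. *)
Lemma fam_grad_line x (s : R) (a : 'rV[R]_n) :
  fam_grad (x + s *: row_mx a 0) =
  fam_grad x + s *: row_mx (t *: a) (a *m (slope_mx q p t (rsubmx x))^T).
Proof.
have rx : rsubmx (x + s *: row_mx a 0) = rsubmx x.
  by rewrite linearD linearZ /= row_mxKr scaler0 addr0.
have gx : gap (x + s *: row_mx a 0) = gap x + s *: a.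
  by rewrite /gap rx linearD linearZ /= row_mxKl addrAC.
rewrite /fam_grad rx gx scale_row_mx add_row_mx; congr row_mx.
  by rewrite scalerDr addrA !scalerA [t * s]mulrC.
by rewrite mulmxDl -scalemxAl.
Qed.

End GeneratingFamily.

(** * Legendrian submanifolds in charts *)

Section LegendrianChart.
Variables (R : realType) (n k : nat) (M : atlas R (n * 2 + 1)).
Variables (eta : forall x : M, covec x) (N : atlas R k) (iota : N -> M).
Hypotheses (cM : contact_manifold eta) (lN : legendrian eta iota).

(** [dform] is made of directional derivatives; these are linear in the direction because the
    contact form is differentiable in the chart. *)
Lemma dform_lin (x : M) (i : idx M) : dom i x -> forall u v v' a,
  dform eta x i (a *: u + v) v' = a * dform eta x i u v' + dform eta x i v v'.
Proof.
move=> ix u v v' a; have [_ /(_ i) sf _] := cM.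
have df : differentiable (form_in eta i) (crd i x).
  by apply: smooth_differentiable sf _; exists x.
rewrite /dform (deriveE _ df) (deriveE u df) (deriveE v df) linearP.
have -> : 'D_v' (form_in eta i) (crd i x) = 'd (form_in eta i) (crd i x) v'.
  by rewrite deriveE.
move: ('d _ _ u) ('d _ _ v) ('d _ _ v') => fu fv fv'.
rewrite pair_mxDl pair_mxZl [pair_mx fv' (_ + _)]pair_mxC pair_mxDl pair_mxZl.
rewrite -!(pair_mxC fv'); ring.
Qed.

Lemma dform_skew (x : M) (i : idx M) u v : dform eta x i u v = - dform eta x i v u.
Proof. by rewrite /dform opprB. Qed.

(** [reeb] and [sharp] are choices with default value 0. The existence of a Reeb vector and the
    invertibility of [flat] show that the defaults are not taken, after which [legendrian_subspace]
    applies. *)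
Lemma legendrian_tangent y (a : idx N) (i : idx M) : dom a y -> dom i (iota y) ->
  (forall v, pair_mx (eta (iota y) i) (tmap iota y a i v) = 0) /\ k = n.
Proof.
move=> ay iy; have [[_ sj _ imm] /(_ y a i ay iy) TE] := lN.
set x := iota y in iy TE *.
have wl := dform_lin iy; have ws := dform_skew x i.
have [_ _ /(_ x i iy) wv] := cM.
have [r0 r0P] := contact_reeb wl ws wv.
have [er wr] : pair_mx (eta x i) (reeb eta x i) = 1 /\
    forall v, dform eta x i (reeb eta x i) v = 0.
  exact: (@xgetPex _ 0 [set r | pair_mx (eta x i) r = 1 /\
    forall v, dform eta x i r v = 0] (ex_intro _ r0 r0P)).
have FU := flat_mx_unit wl ws wv.
have shP b : sharp eta x i b *m flat_mx (dform eta x i) (eta x i) = b.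
  rewrite -(flat_mxE _ wl ws).
  apply: (@xgetPex _ 0 [set v | flat eta x i v = b]).
  exists (b *m invmx (flat_mx (dform eta x i) (eta x i))).
  by rewrite /= /flat (flat_mxE _ wl ws) mulmxKV.
exact: (legendrian_subspace wl ws wv (imm y a i ay iy) er wr shP TE).
Qed.

End LegendrianChart.

Section SpecialContactChart.
Variables (R : realType) (n k : nat).

Lemma diffeo_tmap_inj m l (X : atlas R m) (Y : atlas R l) (f : X -> Y) x
    (i : idx X) (j : idx Y) : manifold X -> {in dom j &, injective (crd j)} ->
  diffeo f -> dom i x -> dom j (f x) -> injective (tmap f x i j).
Proof.
move=> mX jI [g [fK gK sf sg]] ix jfx; apply: (@can_inj _ _ _ (tmap g (f x) j i)) => v.
have igfx : dom i (g (f x)) by rewrite fK.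
rewrite -(tmap_comp (manifold_inj mX) jI sf sg ix jfx igfx).
have -> : g \o f = id by rewrite funeqE => y /=; rewrite fK.
exact: tmap_id.
Qed.

Variables (M : atlas R (n * 2 + 1)) (Q : atlas R n).
Variables (rho : M -> Q) (eta : forall x : M, covec x) (Phi : M -> ecot Q).
Variables (N : atlas R k) (iota : N -> M).
Hypotheses (sc : special_contact rho eta Phi) (lN : legendrian eta iota).

(** Passage to Darboux coordinates: [F] is [Phi \o iota] read in charts, an immersion annihilated by
    [dz - p dq]. The rest of the argument concerns [F] on an open set of Euclidean space. *)
Lemma legendrian_chart (m : N) : k = n /\
  exists (a : idx N) (j : idx Q) (O : set 'rV[R]_k)
         (F : 'rV[R]_k -> 'rV[R]_(n + n + 1)),
  let j' : idx (ecot Q) := (j, tt) in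
  [/\ dom a m /\ O (crd a m), open O /\ O `<=` crd a @` dom a, smooth_on O F,
      forall y, dom a y -> O (crd a y) ->
        dom j' (Phi (iota y)) /\ F (crd a y) = crd j' (Phi (iota y)) &
      forall u, O u -> injective ('d F u) /\
        forall v, pair_mx (row_mx (row_mx (- rsubmx (lsubmx (F u))) 0)
                                  (const_mx 1)) ('d F u v) = 0].
Proof.
have [cM mQ _ [dP _] [mu [mu0 muP]]] := sc.
have [mM _ _] := cM; have [[mN si iI imm] _] := lN.
have sP : smooth_map setT Phi by case: dP => ? [].
have [a am] : exists a : idx N, dom a m by case: mN => /(_ m).
have [i im] : exists i : idx M, dom i (iota m) by case: mM => /(_ (iota m)).
have [j jm] : exists j : idx Q, dom j (cbase (Phi (iota m)).1).
  by case: mQ => /(_ (cbase (Phi (iota m)).1)).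
split; first exact: (legendrian_tangent cM lN am im).2.
pose j' : idx (ecot Q) := (j, tt).
have j'm : dom j' (Phi (iota m)) by [].
have aI := @manifold_inj _ _ _ a mN; have iInj := @manifold_inj _ _ _ i mM.
have jI := @ecot_chart_inj _ _ Q j' mQ.
pose f1 := inchart a (crd i \o iota); pose f2 := inchart i (crd j' \o Phi).
have [op1 s1] := si a i; have [op2 s2] := sP i j'.
rewrite -/(chart_dom iota a i) in op1 s1; rewrite -/(chart_dom Phi i j') in op2 s2.
(* [F] factors through a chart [i] of [M], where the Legendrian condition and the conformal relation
   are stated; [O] keeps the parameters for which both factors are meaningful. *)
pose O := chart_dom iota a i `&` f1 @^-1` chart_dom Phi i j'.
have oO : open O.
  by apply: open_setI_preimage => // u; exact: smooth_continuous s1.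
have OP y : dom a y -> O (crd a y) ->
    [/\ dom i (iota y), dom j' (Phi (iota y)) & f1 (crd a y) = crd i (iota y)].
  move=> ay [/(chart_domE aI ay) iy]; rewrite /preimage /= /f1 inchartE// => P2.
  by split=> //; exact: chart_domE iInj iy P2.
have Oa u : O u -> exists2 y, dom a y & crd a y = u.
  by case=> -[y [[_ ay] _] <-] _; exists y.
exists a, j, O, (f2 \o f1); split.
- split=> //; split; first by exists m.
  by rewrite /preimage /= /f1 inchartE//; exists (iota m).
- by split=> // u /Oa[y ay <-]; exists y.
- move=> l; apply: (@Ck_on_comp _ _ _ _ _ _ (chart_dom Phi i j')) (s2 l) => //.
    by move=> u [].
  by apply: Ck_on_sub (s1 l) => u [].
- by move=> y ay /(OP y ay)[iy jy E]; split=> //; rewrite /= E /f2 inchartE.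
move=> _ /[dup] /Oa[y ay <-] /(OP y ay)[iy jy E].
have dF v : 'd (f2 \o f1) (crd a y) v = tmap Phi (iota y) i j' (tmap iota y a i v).
  rewrite diff_comp; first by rewrite /= E.
    exact: chart_differentiable si ay iy.
  by rewrite E; exact: chart_differentiable sP iy jy.
split.
  move=> v w; rewrite !dF => /(diffeo_tmap_inj mM jI dP iy jy).
  exact: imm.
(* The canonical form pulls back to [mu] times the pullback of [eta], which is zero on [TN]. *)
move=> v; have := muP (iota y) i j' iy jy (tmap iota y a i v).
rewrite (legendrian_tangent cM lN ay iy).1 mulr0 -dF => <-.
rewrite /eta_can; congr (pair_mx (row_mx (row_mx (- _) _) _) _).
by rewrite /= E /f2 inchartE//= row_mxKl row_mxKr.
Qed.

End SpecialContactChart.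

(** * The bundle carrying the generating family *)

Section FamilyBundle.
Variables (R : realType) (n : nat) (Q : atlas R n) (j : idx Q).
Variables (O : set 'rV[R]_n) (y0 : 'rV[R]_n).
Hypotheses (mQ : manifold Q) (oO : open O) (Oy0 : O y0).

Let A : set 'rV[R]_n := crd j @` dom j.
Let jI := @manifold_inj R n Q j mQ.

Lemma open_overlap_preimage (i : idx Q) : open (crd j @` (dom j `&` dom i)).
Proof. by have [_ /(_ j)[_ /(_ i)[]]] := mQ. Qed.

Lemma open_overlap_image (i : idx Q) : open (crd i @` (dom j `&` dom i)).
Proof. by have [_ /(_ j)[_ /(_ i)[]]] := mQ. Qed.

Lemma open_A : open A.
Proof. by rewrite /A -(setIid (dom j)); exact: open_overlap_preimage. Qed.

Lemma smooth_transition (i i' : idx Q) :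
  smooth_on (crd i @` (dom i `&` dom i')) (inchart i (crd i')).
Proof. by have [_ /(_ i)[_ /(_ i')[]]] := mQ. Qed.

Lemma smooth_transition_inv (i i' : idx Q) :
  smooth_on (crd i' @` (dom i `&` dom i')) (inchart i' (crd i)).
Proof. by have [_ /(_ i)[_ /(_ i')[]]] := mQ. Qed.

Local Notation FD := (fam_dom A O).

Definition fam_total : atlas R (n + n) := open_atlas FD.

(** Inverse of the chart [j] on the first block: a preimage is chosen from the proof that this block
    lies in the image of the chart, and it is unique by injectivity. *)
Definition fam_proj (b : fam_total) : Q :=
  s2val (cid2 (svalP b).1).

Lemma open_FD : open FD.
Proof. exact: open_fam_dom open_A oO. Qed.

Lemma manifold_fam_total : manifold fam_total.
Proof. exact: manifold_open_atlas open_FD. Qed.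

Lemma fam_projP b : dom j (fam_proj b) /\ crd j (fam_proj b) = lsubmx (sval b).
Proof. by rewrite /fam_proj; case: cid2. Qed.

Lemma fam_projE b x : dom j x -> crd j x = lsubmx (sval b) -> fam_proj b = x.
Proof.
by have [jb bE] := fam_projP b; move=> jx xE; apply: (chart_inj jI) => //; rewrite bE.
Qed.

Lemma fam_point (x : Q) (y : 'rV[R]_n) : dom j x -> O y ->
  exists b : fam_total, sval b = row_mx (crd j x) y /\ fam_proj b = x.
Proof.
move=> jx yO; have uF : FD (row_mx (crd j x) y).
  by split; rewrite ?row_mxKl ?row_mxKr//; exists x.
exists (exist _ _ uF); split=> //; apply: fam_projE => //.
by rewrite /= row_mxKl.
Qed.

Lemma fam_proj_chart (i : idx fam_total) (i' : idx Q) b : dom i' (fam_proj b) ->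
  inchart i (crd i' \o fam_proj) (sval b) = inchart j (crd i') (lsubmx (sval b)).
Proof.
move=> ib; have [jb bE] := fam_projP b.
rewrite -bE inchartE//; case: b ib jb bE => u uF ib jb bE.
exact: (@inchart_open _ _ FD _ (crd i' \o fam_proj) i u uF).
Qed.

Lemma fam_proj_dom (i : idx fam_total) (i' : idx Q) :
  crd i @` (setT `&` dom i `&` fam_proj @^-1` dom i') =
  FD `&` lsubmx @^-1` (crd j @` (dom j `&` dom i')).
Proof.
apply/seteqP; split=> [_ [b [_ ib] <-]|u [uF [x [jx ix] xu]]].
  have [jb bE] := fam_projP b; split; first exact: svalP b.
  by exists (fam_proj b).
exists (exist _ u uF) => //; split=> //.
by rewrite /preimage /= (@fam_projE (exist _ u uF) x).
Qed.

Lemma open_fam_proj_dom (i' : idx Q) :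
  open (FD `&` lsubmx @^-1` (crd j @` (dom j `&` dom i'))).
Proof.
apply: open_setI_preimage; [exact: open_FD|exact: open_overlap_preimage|move=> u _].
exact: continuous_lsubmx.
Qed.

Lemma smooth_fam_proj : smooth_map setT fam_proj.
Proof.
move=> i i'; rewrite fam_proj_dom.
have oD : open (FD `&` lsubmx @^-1` (crd j @` (dom j `&` dom i'))).
  exact: open_fam_proj_dom.
split=> // l.
have L : Ck_on l (FD `&` lsubmx @^-1` (crd j @` (dom j `&` dom i')))
    (inchart j (crd i') \o lsubmx).
  apply: (@Ck_on_comp _ _ _ _ _ _ (crd j @` (dom j `&` dom i'))) => //.
  - exact: open_overlap_preimage.
  - by move=> u [].
  - by apply: Ck_on_lin => //; exact: continuous_lsubmx.
  - exact: smooth_transition.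
apply: (Ck_on_ext oD _ L) => u; rewrite -(fam_proj_dom i) => -[b [_ ib] <-].
by rewrite fam_proj_chart.
Qed.

Lemma tmap_fam_proj b (i : idx fam_total) (i' : idx Q) v : dom i' (fam_proj b) ->
  tmap fam_proj b i i' v = tmap (@id Q) (fam_proj b) j i' (lsubmx v).
Proof.
move=> ib; have [jb bE] := fam_projP b; rewrite /tmap.
rewrite (@near_diff _ _ _ _ (inchart j (crd i') \o lsubmx)); last first.
  have : \forall u \near crd i b, (FD `&` lsubmx @^-1` (crd j @` (dom j `&` dom i'))) u.
    apply: open_nbhs_nbhs; split; first exact: open_fam_proj_dom.
    by rewrite -(fam_proj_dom i); exists b.
  apply: filterS => u; rewrite -(fam_proj_dom i) => -[b' [_ ib'] <-].
  by rewrite fam_proj_chart.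
rewrite diff_comp /=; first by rewrite bE diff_lin//; exact: continuous_lsubmx.
  exact: differentiable_lsubmx.
apply: (@smooth_differentiable _ _ _ (crd j @` (dom j `&` dom i'))).
  exact: smooth_transition.
by rewrite -bE; exists (fam_proj b).
Qed.

Lemma mopen_chart : mopen (dom j : set Q).
Proof. move=> i; exact: open_overlap_image. Qed.

(** The bundle is trivial with fibre [O], so one trivialisation, given by the second block, serves
    every point of [dom j]. The point [y0] of the fibre makes the projection onto. *)
Lemma fiber_bundle_fam : fiber_bundle (dom j) fam_proj.
Proof.
split; [exact: mopen_chart|exact: smooth_fam_proj| |].
  apply/seteqP; split=> [_ [b _ <-]|x jx]; first by have [] := fam_projP b.
  by have [b [_ bx]] := fam_point jx Oy0; exists b.
exists n, (open_atlas O); split; first exact: manifold_open_atlas.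
move=> x jx; exists (dom j); split=> //; first exact: mopen_chart.
pose F := open_atlas O.
pose h (b : fam_total) : F := exist _ (rsubmx (sval b)) (svalP b).2.
(* [g] must be total on [prodM Q F]; over points outside [dom j] it takes an arbitrary value. *)
have /choice[g gP] (y : prodM Q F) : exists b : fam_total, dom j y.1 ->
    sval b = row_mx (crd j y.1) (sval y.2) /\ fam_proj b = y.1.
  have [jy|jy] := pselect (dom j y.1).
    by have [b bP] := fam_point jy (svalP y.2); exists b.
  by have [b _] := fam_point jx Oy0; exists b.
exists h, g; split.
- move=> i i'; rewrite (@open_crd_image_setT _ _ FD); last first.
    by move=> b; split; [split=> //; exact: (fam_projP b).1|].
  split; first exact: open_FD.
  move=> l; have oF := open_FD.
  apply: (@Ck_on_ext _ _ _ _ _ rsubmx) => //.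
    by move=> u uF; rewrite (@inchart_open _ _ FD _ (crd i' \o h) i u uF).
  by apply: Ck_on_lin => //; exact: continuous_rsubmx.
- case=> i i1 i'; set D := _ @` _.
  pose B := crd i @` (dom j `&` dom i).
  have oD : open (fam_dom B O) by apply: open_fam_dom => //; exact: open_overlap_image.
  have DE : D = fam_dom B O.
    apply/seteqP; split=> [_ [[x' y] [[[/= jx' _] [/= ix' _]] _] <-]|u].
      split; rewrite ?row_mxKl ?row_mxKr; first by exists x'.
      exact: svalP y.
    case=> [[x' [jx' ix'] xu] yO].
    exists (x', exist _ (rsubmx u) yO); first by split.
    by rewrite /= xu hsubmxK.
  rewrite DE; split=> // l.
  have L : Ck_on l (fam_dom B O)
      (fun u => row_mx (inchart i (crd j) (lsubmx u)) (rsubmx u)).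
    apply: Ck_on_row_mx => //; last by apply: Ck_on_lin => //; exact: continuous_rsubmx.
    apply: (@Ck_on_comp _ _ _ _ _ _ B lsubmx (inchart i (crd j))) => //.
    + exact: open_overlap_image.
    + by move=> u [].
    + by apply: Ck_on_lin => //; exact: continuous_lsubmx.
    + exact: smooth_transition_inv.
  apply: (Ck_on_ext oD _ L) => u; rewrite -DE.
  move=> [[x' y] [[[/= jx' _] [/= ix' _]] _] <-].
  have iI := @manifold_inj _ _ _ i mQ.
  rewrite row_mxKl row_mxKr inchartE//.
  have pI : {in dom ((i, i1) : idx (prodM Q F)) &,
      injective (crd ((i, i1) : idx (prodM Q F)))}.
    move=> [a b] [a' b']; rewrite !inE => -[/= ia _] [/= ia' _].
    by move=> /eq_row_mx[/(chart_inj iI ia ia') -> /open_atlas_inj ->].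
  rewrite [RHS](@inchartE _ _ (prodM Q F) _ (i, i1) (crd i' \o g) (x', y) pI)//.
  by rewrite /= (gP (x', y) jx').1.
- move=> b jb; apply: open_atlas_inj; rewrite (gP (fam_proj b, h b) jb).1 /=.
  by rewrite (fam_projP b).2 hsubmxK.
- move=> [x' y] jx'; have [gE gx] := gP (x', y) jx'; split=> //.
  by apply: open_atlas_inj; rewrite /= gE row_mxKr.
Qed.

End FamilyBundle.

(** * Tangent vectors of subsets of a cotangent bundle, given by straight lines *)

Section TangentLines.
Variables (R : realType) (d : nat) (D : set 'rV[R]_d).
Hypothesis oD : open D.
Let X := open_atlas D.

Lemma open_is_covec (x : X) (p : 'rV[R]_d) : is_covec x (fun=> p).
Proof.
split=> [[] [] ix jx v|i []//].
by rewrite (tmap_id v (manifold_open_atlas oD) ix).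
Qed.

Lemma cot_open_point u (p : 'rV[R]_d) : D u -> exists w : cot X,
  forall i : idx (cot X), crd i w = row_mx u p.
Proof.
move=> uD; exists (existT _ (exist _ u uD : X) (Covec (open_is_covec _ p))).
by [].
Qed.

Lemma derive1_affine (V : normedModType R) (c v : V) :
  derive1 (fun s : R => c + s *: v) 0 = v.
Proof.
rewrite /derive1; apply/lim_near_cst => //; near=> h.
rewrite scale0r !addr0 addrC addKr scalerA mulVf ?scale1r//.
by near: h; exact: nbhs_dnbhs_neq.
Unshelve. all: by end_near. Qed.

(** A line in the chart is a smooth curve as long as its base point stays in the open set [D], that
    is for small parameters. Both sets in the Morse condition contain enough such lines. *)
Lemma tangent_line (S : set (cot X)) (w : cot X) (i : idx (cot X)) v :
  (forall (w' : cot X) (s : R), crd i w' = crd i w + s *: v -> S w') ->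
  tangent S w i v.
Proof.
move=> Sline; pose x : 'rV[R]_d := lsubmx (crd i w).
have xD : D x by rewrite /x row_mxKl; exact: svalP (cbase w).
have cline : {for (0 : R), continuous (fun s : R => x + s *: lsubmx v)}.
  by apply: cvgD; [exact: cvg_cst|exact: scalel_continuous].
have /nbhs_ballP[e /= e0 eD] : \forall s \near (0 : R), D (x + s *: lsubmx v).
  by apply: cline; rewrite /= scale0r addr0; exact: open_nbhs_nbhs.
(* [tangent] asks for [g 0 = w] as an equality of points, hence the clause at [s = 0]; outside the
   interval the curve is set to [w]. *)
have /choice[g gP] (s : R) : exists w' : cot X,
    (`|s| < e -> crd i w' = crd i w + s *: v) /\ (s = 0 -> w' = w).
  have [->|s0] := eqVneq s 0; first by exists w; rewrite scale0r addr0.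
  have [se|se] := boolP (`|s| < e); last first.
    by exists w; split=> // /eqP; rewrite (negbTE s0).
  have : D (x + s *: lsubmx v) by apply: eD; rewrite /ball /= sub0r normrN.
  move=> /(cot_open_point (rsubmx (crd i w) + s *: rsubmx v))[w' w'E].
  exists w'; split=> [_|/eqP]; last by rewrite (negbTE s0).
  by rewrite w'E -add_row_mx -scale_row_mx !hsubmxK.
exists e, g; split=> //.
- move=> a a'; set C := _ @` _.
  have CE : C = (fun u : 'rV[R]_1 => u 0 0) @^-1` [set s | `|s| < e].
    apply/seteqP; split=> [_ [s [[/= se _] _] <-]|u /= ue].
      by rewrite /= mxE.
    exists (u 0 0); first by [].
    by apply/rowP => l; rewrite !mxE !ord1.
  have oC : open C.
    rewrite CE; apply: open_comp => [u _|]; first exact: coord_continuous.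
    have -> : [set s : R | `|s| < e] = ball 0 e.
      by apply/seteqP; split=> s; rewrite /ball /= sub0r normrN.
    exact: ball_open.
  split=> // l; rewrite -/C.
  have L : Ck_on l C (fun u : 'rV[R]_1 => crd i w + u 0 0 *: v).
    apply: Ck_on_rV => // b.
    have := Ck_onD oC (Ck_on_cst l C (crd i w 0 b : R))
      (Ck_onM oC (Ck_on_coord 0 oC (Ck_on_id l C)) (Ck_on_cst l C (v 0 b : R))).
    by apply: Ck_on_ext => // u _; rewrite !mxE.
  apply: (Ck_on_ext oC _ L) => _ [s [[/= se _] _] <-].
  have lI : {in dom a &, injective (crd a)}.
    by move=> b b' _ _ /(congr1 (fun u : 'rV_1 => u 0 0)); rewrite !mxE.
  rewrite (@inchartE _ _ (line R) _ a (crd a' \o g) s lI)//= mxE.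
  have -> : a' = i by move: (a') (i) => [] [].
  exact/esym/((gP s).1 se).
- by move=> s se; exact: Sline ((gP s).1 se).
- exact: (gP 0).2.
- rewrite derive1E -[LHS](derive1_affine (crd i w)) derive1E.
  apply: near_eq_derive; apply/nbhs_ballP; exists e => // s.
  by rewrite /ball /= sub0r normrN => /(gP s).1.
Qed.

End TangentLines.

(** * The Morse condition and the generated set *)

Section FamilyMorse.
Variables (R : realType) (n : nat) (Q : atlas R n) (j : idx Q).
Variables (O : set 'rV[R]_n).
Variables (q p : 'rV[R]_n -> 'rV[R]_n) (z : 'rV[R]_n -> R) (t : R).
Hypotheses (mQ : manifold Q) (oO : open O).
Hypotheses (sq : smooth_on O q) (sp : smooth_on O p) (sz : smooth_on O z).
Hypothesis dz : forall y, O y -> forall v,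
  'd (z : _ -> R^o) y v = pair_mx (p y) ('d q y v).
Hypothesis slopeU : forall y, O y -> slope_mx q p t y \in unitmx.

Let A : set 'rV[R]_n := crd j @` dom j.
Let oA : open A := open_A mQ.
Local Notation FD := (fam_dom A O).
Local Notation P := (fam_total j O).
Let oFD : open FD := open_FD mQ oO.
Let tau : P -> Q := @fam_proj R n Q j O.

Definition fam_fun (b : P) : R := fam q p z t (sval b).

Lemma inchart_fam_fun (i : idx P) u : FD u -> inchart i fam_fun u = fam q p z t u.
Proof. by move=> uF; rewrite (@inchart_open _ _ FD _ fam_fun i u uF). Qed.

Lemma dfun_fam b (i : idx P) v :
  dfun fam_fun b i v = pair_mx (fam_grad q p t (sval b)) v.
Proof.
have bF : FD (sval b) := svalP b.
rewrite /dfun -(diff_fam t oA oO sq sp sz dz v bF).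
rewrite (@near_diff _ _ _ _ (fam q p z t))//.
by apply: filterS (open_nbhs_nbhs (conj oFD bF)) => u; exact: inchart_fam_fun.
Qed.

Lemma im_d_fam (w : cot P) (i : idx P) :
  im_d fam_fun w <-> mom w i = fam_grad q p t (sval (cbase w)).
Proof.
split=> [wE|E [] _ v]; last by rewrite dfun_fam -E; case: (i).
by apply: pair_mx_inj => v; rewrite wE// dfun_fam.
Qed.

Lemma vertical_fam b (i : idx P) v : vertical tau b i v <-> lsubmx v = 0.
Proof.
have [jb bE] := fam_projP b; split=> [vV|v0 i' ib].
  by have := vV j jb; rewrite tmap_fam_proj// tmap_id.
by rewrite tmap_fam_proj// v0 /tmap linear0.
Qed.

Lemma conormal_fam (w : cot P) (i : idx P) :
  conormal tau w <-> rsubmx (mom w i) = 0.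
Proof.
have pairE (u v : 'rV[R]_(n + n)) : pair_mx u v =
    pair_mx (lsubmx u) (lsubmx v) + pair_mx (rsubmx u) (rsubmx v).
  by rewrite -pair_row_mx !hsubmxK.
split=> [wC|w0 [] _ v /vertical_fam v0].
  apply: pair_mx_inj => v; rewrite pair_mx0l.
  have := wC i I (row_mx 0 v); rewrite pairE row_mxKl row_mxKr pair_mx0r add0r; apply.
  by apply/vertical_fam; rewrite row_mxKl.
by move: w0; case: i => w0; rewrite pairE w0 v0 pair_mx0l pair_mx0r addr0.
Qed.

Lemma morse_fam : morse_family tau fam_fun.
Proof.
split.
  move=> i i'; rewrite (@open_crd_image_setT _ _ FD); last by move=> b; split.
  split=> // l; have L : Ck_on l FD (fun u => const_mx (fam q p z t u) : 'rV_1).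
    apply: Ck_on_rV => // a; have := smooth_fam t oA oO sq sp sz l.
    by apply: Ck_on_ext => // u _; rewrite mxE.
  apply: (Ck_on_ext oFD _ L) => u uF.
  by rewrite (@inchart_open _ _ FD _ (crd i' \o (fam_fun : P -> line R)) i u uF).
move=> w wE wC i _ v; pose b : 'rV_(n + n) := sval (cbase w).
pose S := slope_mx q p t (rsubmx b).
have SU : S^T \in unitmx by rewrite unitmx_tr slopeU//; case: (svalP (cbase w)).
(* Moving the base by [a] changes the fibre part of the gradient by [a *m S^T], so this [a] yields a
   tangent vector [va] of the graph with the same fibre momentum [c] as [v]. The difference [v - va]
   has no fibre momentum and is tangent to the conormal bundle. *)
pose c : 'rV[R]_n := rsubmx (rsubmx v); pose a := c *m invmx S^T.
pose va : 'rV[R]_((n + n) + (n + n)) := row_mx (row_mx a 0) (row_mx (t *: a) c).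
have wG := (im_d_fam w i).1 wE; have w0 := (conormal_fam w i).1 wC.
exists va, (v - va); split; last by rewrite addrC subrK.
- apply: (tangent_line oFD) => w' s w'E; apply/(im_d_fam w' i).
  move: w'E; rewrite /= /va scale_row_mx add_row_mx => /eq_row_mx[bE mE].
  rewrite [sval (cbase w')]bE fam_grad_line -/b -/S.
  by rewrite [mom w' i]mE -/(mom w i) wG /a mulmxKV.
apply: (tangent_line oFD) => w' s w'E; apply/(conormal_fam w' i).
have -> : mom w' i = rsubmx (crd i w') by rewrite row_mxKr.
have vv : rsubmx (rsubmx (v - va)) = 0 by rewrite !linearB /= !row_mxKr subrr.
rewrite w'E; move: (v - va) vv => e e0.
by rewrite linearD linearD /= row_mxKr w0 add0r linearZ linearZ /= e0 scaler0.
Qed.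

Lemma generated_fam (w : ecot Q) :
  (exists2 y, O y & dom j (cbase w.1) /\
     crd ((j, tt) : idx (ecot Q)) w = row_mx (row_mx (q y) (p y)) (const_mx (z y))) ->
  generated tau fam_fun w.
Proof.
case=> y yO [jw]; rewrite /= => /eq_row_mx[/eq_row_mx[wq wp] wz].
have {}wz : w.2 = z y by have := congr1 (fun u : 'rV_1 => u 0 0) wz; rewrite !mxE.
have [b [bE bw]] := fam_point mQ jw yO.
have g0 : gap q (sval b) = 0 by rewrite /gap bE row_mxKl row_mxKr -wq subrr.
have [fE gE] := fam_gap0 p z t g0; rewrite bE row_mxKr -bE in fE gE.
(* These bundle coordinates are global, and [c] is then the chart of the total space itself. *)
exists b, setT, j, (fun b => rsubmx (sval b)) => c dE.
have cE : c = @crd R _ P tt.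
  by rewrite funeqE => b'; rewrite /c (fam_projP b').2 hsubmxK.
have dEE v : dE v = pair_mx (row_mx (p y) 0) v.
  by rewrite /dE cE -gE -(dfun_fam b tt).
split.
- split=> //; split; first by move=> _ [b' _ <-]; exact: (fam_projP b').1.
  by rewrite -/c cE; have [_ /(_ tt)] := manifold_fam_total j mQ oO.
- exact: esym bw.
- by move=> u; rewrite dEE -wp pair_row_mx pair_mx0l addr0.
- by rewrite wz -fE.
- by move=> u; rewrite dEE pair_row_mx pair_mx0l pair_mx0r addr0.
Qed.

(* The gradient of the family at the point [b] witnessing [generated], read in the
   standard chart: the fibre derivative vanishes in any bundle coordinates, so only
   the transition of base charts enters. *)
Lemma generated_grad (w : ecot Q) : generated tau fam_fun w ->
  exists b : P, [/\ cbase w.1 = tau b, w.2 = fam_fun b &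
    fam_grad q p t (sval b) = row_mx (mom w.1 j) 0].
Proof.
case=> b [D [j' [eps]]]; set c := (fun b => row_mx _ _).
move=> [[[tD [cI cS]] Db] wb wp wz wd]; exists b; split=> //.
pose tt' : idx P := tt; have [opc opD sc sD] := cS tt'.
pose x := sval b; pose T := inchart tt' c; pose Ec : _ -> R^o := along D c fam_fun.
pose OD : set 'rV_(n + n) := crd tt' @` (D `&` dom tt').
have ODx : OD x by exists b.
have nearD : \forall u \near x, OD u by apply: open_nbhs_nbhs.
have tI : {in dom tt' &, injective (crd tt')} by exact: open_crd_inj.
have TE b' : T (sval b') = c b' by exact: (inchartE _ tI).
have Tx : T x = c b by exact: TE.
have dT : differentiable T x by exact: smooth_differentiable sD ODx.
have dEc : differentiable Ec (c b).
  have cb : (c @` (D `&` dom tt')) (c b) by exists b.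
  apply: (@near_differentiable _ _ _ (fam q p z t \o along D c (crd tt'))).
    apply: filterS (open_nbhs_nbhs (conj opc cb)) => _ [b' [Db' _] <-].
    by rewrite /Ec /= !alongE.
  apply: differentiable_comp; first exact: smooth_differentiable sc cb.
  rewrite alongE//; apply: (smooth_differentiable (smooth_fam t oA oO sq sp sz)).
  exact: svalP b.
have bF : FD x by exact: svalP b.
have jt' b' : D b' -> dom j' (tau b') by move=> Db'; apply: tD; exists b'.
have jb : dom j (cbase w.1) by rewrite wb; exact: (fam_projP b).1.
(* Both coordinate systems lie over the same projection, so the base block of their transition is
   the change of charts from [j] to [j'] on [Q]. *)
have dTl v : lsubmx ('d T x v) = tmap (@id Q) (cbase w.1) j j' (lsubmx v).
  rewrite wb -(@tmap_fam_proj _ _ _ _ _ mQ oO b tt' j' v (jt' b Db)).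
  transitivity ('d (lsubmx \o T) x v).
    rewrite diff_comp//; last exact: differentiable_lsubmx.
    by rewrite /= diff_lin//; exact: continuous_lsubmx.
  apply: (congr1 (fun f : _ -> _ => f v)); apply: near_diff.
  apply: filterS nearD => _ [b' [Db' _] <-].
  by rewrite /= TE row_mxKl (inchartE _ tI).
apply: pair_mx_inj => v.
rewrite -(diff_fam t oA oO sq sp sz dz v bF).
have -> : 'd (fam q p z t : _ -> R^o) x v = 'd Ec (c b) ('d T x v).
  have dEcT : differentiable Ec (T x) by rewrite Tx.
  rewrite -Tx; transitivity ('d (Ec \o T) x v); last first.
    exact: (congr1 (fun f : _ -> _ => f v) (diff_comp dT dEcT)).
  apply: (congr1 (fun f : _ -> _ => f v)); apply: near_diff.
  by apply: filterS nearD => _ [b' [Db' _] <-]; rewrite /= TE /Ec alongE.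
rewrite -['d T x v]hsubmxK dTl.
have dEcr (u u' : 'rV[R]_n) : 'd Ec (c b) (row_mx u u') = pair_mx (mom w.1 j') u.
  transitivity ('d Ec (c b) (row_mx u 0 + row_mx 0 u')).
    by rewrite add_row_mx addr0 add0r.
  by rewrite linearD [X in _ + X]wd addr0 wp.
rewrite dEcr.
have j'b : dom j' (cbase w.1) by rewrite wb; exact: jt'.
(* The transformation law of the covector [w.1] absorbs the change of base charts. *)
rewrite -((cmpP (tagged w.1)).1 j j' jb j'b).
by rewrite -[v in RHS]hsubmxK pair_row_mx pair_mx0l addr0.
Qed.

Lemma generated_famE (w : ecot Q) :
  generated tau fam_fun w -> exists2 y, O y & dom j (cbase w.1) /\
    crd ((j, tt) : idx (ecot Q)) w = row_mx (row_mx (q y) (p y)) (const_mx (z y)).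
Proof.
move=> /generated_grad[b [wb wz gE]]; have [_ yO] := svalP b.
have g0 : gap q (sval b) = 0.
  by apply: (fam_critical slopeU (svalP b)); rewrite gE row_mxKr.
have [fE gE'] := fam_gap0 p z t g0.
exists (rsubmx (sval b)) => //; split; first by rewrite wb; exact: (fam_projP b).1.
move: gE; rewrite gE' => /eq_row_mx[mE _].
rewrite /=; congr (row_mx (row_mx _ _) (const_mx _)).
- rewrite -/(cbase w.1) wb (fam_projP b).2.
  by move/eqP: g0; rewrite subr_eq0 => /eqP.
- by rewrite mE.
- by rewrite wz -fE.
Qed.

End FamilyMorse.

(** * Base, momentum and height components of a Legendrian chart *)

Section Blocks.
Variables (R : realType) (n : nat) (O : set 'rV[R]_n).
Variables (F : 'rV[R]_n -> 'rV[R]_(n + n + 1)).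
Hypotheses (oO : open O) (sF : smooth_on O F).

Definition base_part (u : 'rV[R]_n) : 'rV[R]_n := lsubmx (lsubmx (F u)).
Definition momentum_part (u : 'rV[R]_n) : 'rV[R]_n := rsubmx (lsubmx (F u)).
Definition height_part (u : 'rV[R]_n) : R := (rsubmx (F u) : 'rV_1) 0 0.

Lemma blocksE u :
  F u = row_mx (row_mx (base_part u) (momentum_part u)) (const_mx (height_part u)).
Proof.
rewrite /base_part /momentum_part hsubmxK -[LHS]hsubmxK; congr row_mx.
by apply/rowP => i; rewrite [RHS]mxE /height_part !ord1.
Qed.

Lemma smooth_base_part : smooth_on O base_part.
Proof.
move=> l; apply: (@Ck_on_lin_comp _ _ _ _ _ _ (fun u => lsubmx (F u)) lsubmx) => //.
  exact: continuous_lsubmx.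
apply: (@Ck_on_lin_comp _ _ _ _ _ _ F lsubmx) => //; exact: continuous_lsubmx.
Qed.

Lemma smooth_momentum_part : smooth_on O momentum_part.
Proof.
move=> l; apply: (@Ck_on_lin_comp _ _ _ _ _ _ (fun u => lsubmx (F u)) rsubmx) => //.
  exact: continuous_rsubmx.
apply: (@Ck_on_lin_comp _ _ _ _ _ _ F lsubmx) => //; exact: continuous_lsubmx.
Qed.

Lemma smooth_height_part : smooth_on O height_part.
Proof.
move=> l; apply: (@Ck_on_coord _ _ _ _ _ (fun u => rsubmx (F u) : 'rV_1)) => //.
apply: (@Ck_on_lin_comp _ _ _ _ _ _ F rsubmx) => //; exact: continuous_rsubmx.
Qed.

Lemma diff_lin_comp m l (L : {linear 'rV[R]_m -> 'rV[R]_l})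
    (f : 'rV[R]_n -> 'rV[R]_m) u v :
  differentiable f u -> 'd (L \o f) u v = L ('d f u v).
Proof.
move=> df; have cL := @linear_rV_continuous _ _ _ L.
rewrite diff_comp//; last exact: linear_differentiable.
by rewrite /= diff_lin.
Qed.

Lemma diff_base_part u v : O u -> 'd base_part u v = lsubmx (lsubmx ('d F u v)).
Proof.
move=> Ou; have dF := smooth_differentiable sF Ou.
have dl : differentiable (lsubmx \o F) u.
  by apply: differentiable_comp => //; exact: differentiable_lsubmx.
transitivity (lsubmx ('d (lsubmx \o F) u v)); first exact: (diff_lin_comp lsubmx v dl).
by congr lsubmx; exact: (diff_lin_comp lsubmx v dF).
Qed.

Lemma diff_momentum_part u v : O u -> 'd momentum_part u v = rsubmx (lsubmx ('d F u v)).
Proof.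
move=> Ou; have dF := smooth_differentiable sF Ou.
have dl : differentiable (lsubmx \o F) u.
  by apply: differentiable_comp => //; exact: differentiable_lsubmx.
transitivity (rsubmx ('d (lsubmx \o F) u v)); first exact: (diff_lin_comp rsubmx v dl).
by congr rsubmx; exact: (diff_lin_comp lsubmx v dF).
Qed.

Lemma diff_height_part u v : O u ->
  'd (height_part : _ -> R^o) u v = (rsubmx ('d F u v) : 'rV_1) 0 0.
Proof.
move=> Ou; have dF := smooth_differentiable sF Ou.
have dr : differentiable (rsubmx \o F) u.
  by apply: differentiable_comp => //; exact: differentiable_rsubmx.
rewrite -deriveE; last exact: smooth_differentiable smooth_height_part Ou.
transitivity (('d (rsubmx \o F) u v : 'rV_1) 0 0); first exact: (diff_coord v 0 dr).
by congr (fun_of_matrix _ 0 0); exact: (diff_lin_comp rsubmx v dF).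
Qed.

Hypothesis contactF : forall u, O u -> forall v,
  pair_mx (row_mx (row_mx (- rsubmx (lsubmx (F u))) 0) (const_mx 1)) ('d F u v) = 0.

Lemma contact_height u : O u -> forall v,
  'd (height_part : _ -> R^o) u v = pair_mx (momentum_part u) ('d base_part u v).
Proof.
move=> Ou v; rewrite diff_height_part// diff_base_part//.
have := contactF Ou v; rewrite -/(momentum_part u).
move: ('d F u v) => w; rewrite -{1}[w]hsubmxK -{1}[lsubmx w]hsubmxK.
rewrite !pair_row_mx pair_mx0l addr0 -scaleN1r pair_mxZl mulN1r.
have -> : pair_mx (const_mx 1) (rsubmx w : 'rV_1) = (rsubmx w : 'rV_1) 0 0.
  by rewrite /pair_mx big_ord1 mxE mul1r.
by move=> /eqP; rewrite addrC subr_eq0 => /eqP.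
Qed.

(** The derivative of the height is [p dq], so it vanishes together with [dq]; injectivity of
    ['d F u] is therefore already that of the pair [(dq, dp)], as choosing a slope requires. *)
Lemma base_momentum_immersion u : O u -> injective ('d F u) -> forall v,
  'd base_part u v = 0 -> 'd momentum_part u v = 0 -> v = 0.
Proof.
move=> Ou Finj v qv pv.
have zv := etrans (esym (diff_height_part v Ou))
  (etrans (contact_height Ou v) (etrans (congr1 (pair_mx _) qv) (pair_mx0r _))).
have {}qv := etrans (esym (diff_base_part v Ou)) qv.
have {}pv := etrans (esym (diff_momentum_part v Ou)) pv.
apply: Finj; rewrite linear0.
move: ('d F u v) zv qv pv => w zv qv pv.
rewrite -[w]hsubmxK -[lsubmx w]hsubmxK qv pv !row_mx0.
suff -> : rsubmx w = 0 by rewrite !row_mx0.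
by apply/rowP => i; rewrite ord1 zv mxE.
Qed.

End Blocks.

(** * Assembly of the local generating family *)

Theorem theorem2p1 (R : realType) (n k : nat)
    (M : atlas R (n * 2 + 1)) (Q : atlas R n)
    (rho : M -> Q) (eta : forall x : M, covec x) (Phi : M -> ecot Q)
    (N : atlas R k) (iota : N -> M) :
  special_contact rho eta Phi ->
  legendrian eta iota ->
  forall m : N,
  exists (U : set N) (V : set Q) (l : nat) (P : atlas R (n + l))
         (tau : P -> Q) (E : P -> R),
    [/\ mopen U /\ U m,
        manifold P /\ fiber_bundle V tau,
        morse_family tau E &
        (Phi \o iota) @` U = generated tau E].
Proof.
move=> sc lN m; have [kn] := legendrian_chart sc lN m; subst k.
move=> [a [j [B [F [[am Om] [oB Oa] sF FE dF]]]]].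
have [_ mQ _ _ _] := sc; have [[mN _ _ _] _] := lN.
have aI := @manifold_inj _ _ _ a mN.
have jI := @ecot_chart_inj _ _ Q (j, tt) mQ.
pose q := base_part F; pose p := momentum_part F; pose z := height_part F.
have contactF u (Ou : B u) := (dF u Ou).2.
have dz := contact_height oB sF contactF.
have imm := base_momentum_immersion oB sF contactF Om (dF _ Om).1.
have sq := smooth_base_part oB sF; have sp := smooth_momentum_part oB sF.
have sz := smooth_height_part oB sF.
have [t tU] := exists_slope oB sq sp sz dz Om imm.
pose B1 := [set y | B y /\ slope_mx q p t y \in unitmx].
have oB1 : open B1 by exact: open_slope_unit.
have sub1 (W : normedModType R) (f : 'rV[R]_n -> W) : smooth_on B f -> smooth_on B1 f.
  by move=> sf l; apply: Ck_on_sub (sf l) => u [].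
have sq1 := sub1 _ _ sq; have sp1 := sub1 _ _ sp; have sz1 := sub1 _ _ sz.
have dz1 y (O1y : B1 y) := dz y O1y.1.
have slopeU y (O1y : B1 y) := O1y.2.
pose U := [set y | dom a y /\ B1 (crd a y)].
(* The base is the whole domain of the chart [j] and the fibre is [B1]; over these the critical set
   is exactly [x = q(y)], so [U] is the part of the chart [a] with parameters in [B1]. *)
exists U, (dom j), n, (fam_total j B1), (@fam_proj R n Q j B1), (fam_fun q p z t).
split.
- split=> // i.
  (* [U] is described in the chart [a], but [mopen] tests every chart [i]: in it, [U] is the
     preimage of [B1] under the transition map. *)
  have -> : crd i @` (U `&` dom i) =
      crd i @` (dom a `&` dom i) `&` inchart i (crd a) @^-1` B1.
    have iI := @manifold_inj _ _ _ i mN.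
    apply/seteqP; split=> [_ [y [[ay Oy] iy] <-]|_ [[y [ay iy] <-]]].
      by split; [exists y|rewrite /preimage /= inchartE].
    by rewrite /preimage /= inchartE// => Oy; exists y.
  apply: open_setI_preimage => //; first exact: open_overlap_image.
  by move=> u; apply: smooth_continuous; exact: smooth_transition_inv.
- split; first exact: manifold_fam_total.
  exact: (@fiber_bundle_fam _ _ _ _ _ (crd a m) mQ oB1 (conj Om tU)).
- exact: (@morse_fam _ _ _ _ _ _ _ _ _ mQ oB1 sq1 sp1 sz1 dz1 slopeU).
have chartE y : dom a y -> B (crd a y) -> crd ((j, tt) : idx (ecot Q)) (Phi (iota y)) =
    row_mx (row_mx (q (crd a y)) (p (crd a y))) (const_mx (z (crd a y))).
  by move=> ay Oy; rewrite -(FE y ay Oy).2 -blocksE.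
apply/seteqP; split=> [_ [y [ay [Oy Uy]] <-]|w].
  apply: (generated_fam t mQ oB1 sq1 sp1 sz1 dz1).
  exists (crd a y) => //; split; last exact: chartE.
  by have [[]] := FE y ay Oy.
move=> /(generated_famE mQ oB1 sq1 sp1 sz1 dz1 slopeU)[u [Ou Uu] [jw wE]].
have [y ay yE] := Oa u Ou; subst u.
exists y; first by [].
have [jy _] := FE y ay Ou.
(* [w] and [Phi (iota y)] have the same coordinates in the chart over [j], hence coincide. *)
by apply: (chart_inj jI) => //; rewrite chartE.
Qed.
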